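(* Let $X \subset S^7$ be such that $A(X) \subseteq \{\pm\frac{1}{5}, \pm\frac{3}{5}\}$. Then $|X| \le 126$, and $|X| = 126$ only if $X \simeq X_8$.
   Context: $S^{n-1}$ is the unit sphere of $\mathbb{R}^n$ and $(\cdot,\cdot)$ the standard inner product. For $X \subseteq \mathbb{R}^n$, $A(X) := \{(x,x') \mid x,x' \in X,\ x \neq x'\}$. The norm of $x$ is $N(x) := (x,x)$, and for a lattice $L$, $S(L) := \{x \in L \mid N(x) = 2\}$ is the set of its roots. Let $e_1,\dots,e_8$ be the standard basis of $\mathbb{R}^8$, $\mathbf{1}$ the all-one vector of $\mathbb{R}^8$, $D_8$ the lattice generated over $\mathbb{Z}$ by the vectors $e_i \pm e_j$ ($1 \le i,j \le 8$), $E_8$ the lattice generated over $\mathbb{Z}$ by $D_8$ and $\frac{1}{2}\mathbf{1}$, and $E_7 := E_8 \cap x^\perp$ for a root $x$ of $E_8$ (up to isometry, the choice of $x$ does not matter). The lattice $E_7$ has rank $7$, and its linear span is identified isometrically with $\mathbb{R}^7$. Define $$X_8 := \Bigl\{ \bigl[\sqrt{\tfrac{2}{5}}\, x, \sqrt{\tfrac{1}{5}}\bigr] \;\Big|\; x \in S(E_7) \Bigr\} \subset S^7,$$ where $[\cdot,\cdot]$ denotes concatenation of coordinates; $|X_8| = 126$. For $X, X' \subseteq S^{d-1}$, $X \simeq X'$ (equivalence) means that $X'$ can be obtained from $X$ by applying an orthogonal transformation of $\mathbb{R}^d$ and replacing some of the vectors by their opposites. *)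

(* Defs.v *)
From HB Require Import structures.
From mathcomp Require Import all_boot all_order all_algebra.
From mathcomp Require Import boolp classical_sets functions cardinality reals.
Set Implicit Arguments.
Unset Strict Implicit.
Unset Printing Implicit Defensive.
Import Order.TTheory GRing.Theory Num.Theory.
Local Open Scope classical_set_scope.
Local Open Scope ring_scope.

Section Euclidean.
Context {R : realType}.

Definition inner n (x y : 'rV[R]_n) : R := \sum_(i < n) x 0 i * y 0 i.

Definition normN n (x : 'rV[R]_n) : R := inner x x.

Definition sphere n : set 'rV[R]_n := [set x | inner x x = 1].

Definition inner_values n (X : set 'rV[R]_n) : set R :=
  [set a | exists x y, [/\ X x, X y, x != y & a = inner x y]].

Definition Zspan n (G : set 'rV[R]_n) : set 'rV[R]_n :=
  [set v | exists (m : nat) (g : 'I_m -> 'rV[R]_n) (c : 'I_m -> int),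
     (forall i, G (g i)) /\ v = \sum_(i < m) g i *~ c i].

Definition Rspan n (G : set 'rV[R]_n) : set 'rV[R]_n :=
  [set v | exists (m : nat) (g : 'I_m -> 'rV[R]_n) (c : 'I_m -> R),
     (forall i, G (g i)) /\ v = \sum_(i < m) c i *: g i].

Definition lattice_roots n (L : set 'rV[R]_n) : set 'rV[R]_n :=
  [set x | L x /\ normN x = 2].

Definition std_basis n (i : 'I_n) : 'rV[R]_n := delta_mx 0 i.

Definition D8 : set 'rV[R]_8 :=
  Zspan [set v | exists i j : 'I_8,
           v = std_basis i + std_basis j \/ v = std_basis i - std_basis j].

Definition E8 : set 'rV[R]_8 := Zspan (D8 `|` [set 2^-1 *: const_mx 1]).

Definition E7 (r : 'rV[R]_8) : set 'rV[R]_8 := E8 `&` [set v | inner v r = 0].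

(* f restricts to a linear isometry of the real span of L onto R^m; the values
   of f outside this span are irrelevant. *)
Definition isometric_identification n m (L : set 'rV[R]_n)
    (f : {linear 'rV[R]_n -> 'rV[R]_m}) : Prop :=
  (forall u v, Rspan L u -> Rspan L v -> inner (f u) (f v) = inner u v) /\
  f @` Rspan L = setT.

(* Meaningful when r is a root of E_8 and f an isometric identification of the
   span of E_7 r with R^7. *)
Definition X8 (r : 'rV[R]_8) (f : {linear 'rV[R]_8 -> 'rV[R]_7}) :
    set 'rV[R]_(7 + 1) :=
  [set row_mx (Num.sqrt (2 / 5) *: f x) (const_mx (Num.sqrt (1 / 5)))
     | x in lattice_roots (E7 r)].

Definition orthogonal_matrix d (Q : 'M[R]_d) : Prop := Q *m Q^T = 1%:M.

(* The vectors x with s x = true are the ones replaced by their opposites. *)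
Definition equivalent d (X X' : set 'rV[R]_d) : Prop :=
  exists (Q : 'M[R]_d) (s : 'rV[R]_d -> bool),
    orthogonal_matrix Q /\ X' = [set (-1) ^+ s x *: (x *m Q) | x in X].

End Euclidean.

Arguments sphere {R} n _.

(* Main.v *)
(** Rescale X to vectors w of norm 10 with pairwise inner products ±2, ±6.
    Suppose first that some r of norm 2 (a pole) has (r, w) = ±2 for all w.
    Then the vectors u = (±w - r)/2 are roots (norm 2, integral inner products)
    orthogonal to r, and two nested second-moment inequalities
    |sum v^T v - c P|^2 >= 0 bound their number: the roots having inner product
    1 with a fixed root number at most 32 (in rank 6), hence there are at most
    126 roots (in rank 7). If there is no pole, the vectors (w ± w')/2 with
    (w, w') = ∓6 have pairwise inner products 0 and 1 and inner product 1 with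
    h = w/2; their outer products are linearly independent even modulo
    h (x) R^8 inside Sym^2 R^8, so there are at most 36 - 8 = 28 of them, and
    a second moment gives at most 116 vectors.
    When there are 126 vectors all these inequalities are equalities, and they
    force the roots u to contain a basis of E_7 with a prescribed Gram matrix;
    every norm 2 vector of the dual of its span already lies in the span, so by
    maximality u is exactly the set of such vectors. Hence all sets X of size
    126 are equivalent, and it remains to see that X_8 has 126 elements. Of the
    240 roots of E_8, at most 1 + 1 are ±r and at most 56 + 56 have inner
    product ±1 with r (the same moment inequality in rank 7), which leaves at
    least 126 in E_7. *)
Require Import Defs.
From HB Require Import structures.
From mathcomp Require Import all_boot all_order all_algebra.
From mathcomp Require Import boolp classical_sets functions cardinality reals.
From mathcomp Require Import ring lra zify.
Set Implicit Arguments.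
Unset Strict Implicit.
Unset Printing Implicit Defensive.
Import Order.TTheory GRing.Theory Num.Theory.
Local Open Scope classical_set_scope.
Local Open Scope ring_scope.

(** * Inner products of row vectors *)

Section InnerProduct.
Context {R : realType} {n : nat}.
Implicit Types x y z : 'rV[R]_n.

Lemma innerE x y : inner x y = (x *m y^T) 0 0.
Proof. by rewrite mxE; apply: eq_bigr => i _; rewrite mxE. Qed.

Lemma mulmx_inner x y : x *m y^T = (inner x y)%:M.
Proof. by rewrite [LHS]mx11_scalar innerE. Qed.

Lemma innerC x y : inner x y = inner y x.
Proof. by apply: eq_bigr => i _; rewrite mulrC. Qed.

Lemma innerDl x y z : inner (x + y) z = inner x z + inner y z.
Proof. by rewrite !innerE mulmxDl mxE. Qed.

Lemma innerZl a x y : inner (a *: x) y = a * inner x y.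
Proof. by rewrite !innerE -scalemxAl mxE. Qed.

Lemma innerNl x y : inner (- x) y = - inner x y.
Proof. by rewrite -scaleN1r innerZl mulN1r. Qed.

Lemma innerBl x y z : inner (x - y) z = inner x z - inner y z.
Proof. by rewrite innerDl innerNl. Qed.

Lemma innerDr x y z : inner x (y + z) = inner x y + inner x z.
Proof. by rewrite innerC innerDl !(innerC x). Qed.

Lemma innerZr a x y : inner x (a *: y) = a * inner x y.
Proof. by rewrite innerC innerZl innerC. Qed.

Lemma innerNr x y : inner x (- y) = - inner x y.
Proof. by rewrite innerC innerNl innerC. Qed.

Lemma innerBr x y z : inner x (y - z) = inner x y - inner x z.
Proof. by rewrite innerDr innerNr. Qed.

Lemma inner_suml (I : finType) (K : {pred I}) (f : I -> 'rV[R]_n) y :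
  inner (\sum_(i in K) f i) y = \sum_(i in K) inner (f i) y.
Proof.
rewrite innerE mulmx_suml summxE; apply: eq_bigr => i _.
by rewrite -innerE.
Qed.

Lemma inner_outer x y a b : inner (x *m (a^T *m b)) y = inner x a * inner b y.
Proof.
rewrite innerE !mulmxA -mulmxA !mulmx_inner -scalar_mxM mxE eqxx.
by rewrite mulr1n.
Qed.

Lemma inner0l x : inner 0 x = 0.
Proof. by rewrite -(scale0r 0) innerZl mul0r. Qed.

Lemma inner_ge0 x : 0 <= inner x x.
Proof. by apply: sumr_ge0 => i _; rewrite -expr2 sqr_ge0. Qed.

Lemma inner_eq0 x : inner x x = 0 -> x = 0.
Proof.
move=> /eqP; rewrite psumr_eq0; last by move=> i _; rewrite -expr2 sqr_ge0.
move=> /allP x0; apply/rowP => i; rewrite mxE.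
by have := x0 i (mem_index_enum i); rewrite /= mulf_eq0 orbb => /eqP.
Qed.

Lemma inner_mulmx (Q : 'M[R]_n) x y :
  Q *m Q^T = 1%:M -> inner (x *m Q) (y *m Q) = inner x y.
Proof.
by move=> QQ; rewrite !innerE trmx_mul mulmxA -(mulmxA x) QQ mulmx1.
Qed.

End InnerProduct.

Definition innerE2 := (@innerDl, @innerDr, @innerBl, @innerBr, @innerNl,
  @innerNr, @innerZl, @innerZr).

(** * Second-moment matrices and the Frobenius norm *)

Section Moment.
Context {R : realType} {n : nat} (T : finType).
Implicit Types (K : {pred T}) (v : T -> 'rV[R]_n) (P : 'M[R]_n).

Definition moment_mx K v : 'M[R]_n := \sum_(i in K) (v i)^T *m v i.

Lemma frob_ge0 (A : 'M[R]_n) : 0 <= \tr (A *m A^T).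
Proof.
apply: sumr_ge0 => i _; rewrite mxE; apply: sumr_ge0 => j _.
by rewrite !mxE -expr2 sqr_ge0.
Qed.

Lemma frob_eq0 (A : 'M[R]_n) : \tr (A *m A^T) = 0 -> A = 0.
Proof.
move=> A0; apply/matrixP => i j; rewrite mxE.
have ge0 k l : 0 <= A k l * A^T l k by rewrite mxE -expr2 sqr_ge0.
have {A0} : \sum_k \sum_l A k l * A^T l k = 0.
  by rewrite -[RHS]A0; apply: eq_bigr => k _; rewrite mxE.
move=> /(psumr_eq0P (fun k _ => sumr_ge0 _ (fun l _ => ge0 k l))).
move=> /(_ i isT) /(psumr_eq0P (fun l _ => ge0 i l)) /(_ j isT).
by rewrite mxE => /eqP; rewrite mulf_eq0 orbb => /eqP.
Qed.

Lemma inner_moment_mx K v x y :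
  inner (x *m moment_mx K v) y = \sum_(i in K) inner x (v i) * inner y (v i).
Proof.
rewrite /moment_mx mulmx_sumr inner_suml; apply: eq_bigr => i _.
by rewrite inner_outer (innerC y).
Qed.

(** The square expands because [P] acts as the identity on the moment matrix from both sides. With
    [c] the total norm divided by the rank of [P], nonnegativity of the left side bounds the sum of
    squared inner products from below; equality means a tight frame. *)
Lemma moment_frob K v P (c : R) :
  P^T = P -> P *m P = P -> (forall i, i \in K -> v i *m P = v i) ->
  let A := moment_mx K v - c *: P in
  \tr (A *m A^T) = \sum_(i in K) \sum_(j in K) inner (v i) (v j) ^+ 2
     - 2 * c * (\sum_(i in K) inner (v i) (v i)) + c ^+ 2 * \tr P.
Proof.
move=> Ps PP vP A.
have Ms : (moment_mx K v)^T = moment_mx K v.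
  rewrite /moment_mx raddf_sum; apply: eq_bigr => i _ /=.
  by rewrite trmx_mul trmxK.
have As : A^T = A by rewrite /A linearB linearZ /= Ms Ps.
have MP : moment_mx K v *m P = moment_mx K v.
  rewrite /moment_mx mulmx_suml; apply: eq_bigr => i iK.
  by rewrite -mulmxA vP.
have PM : P *m moment_mx K v = moment_mx K v.
  by rewrite -[LHS]trmxK trmx_mul Ms Ps MP Ms.
have trM : \tr (moment_mx K v) = \sum_(i in K) inner (v i) (v i).
  rewrite /moment_mx raddf_sum; apply: eq_bigr => i _ /=.
  by rewrite mxtrace_mulC mulmx_inner mxtrace_scalar.
have trMM : \tr (moment_mx K v *m moment_mx K v)
    = \sum_(i in K) \sum_(j in K) inner (v i) (v j) ^+ 2.
  rewrite {1}/moment_mx mulmx_suml raddf_sum; apply: eq_bigr => i _ /=.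
  rewrite -mulmxA mxtrace_mulC.
  by rewrite mulmx_inner mxtrace_scalar inner_moment_mx.
rewrite As /A mulmxBl !mulmxBr -!scalemxAl -!scalemxAr MP PM PP.
by rewrite !raddfB /= !mxtraceZ trM trMM; ring.
Qed.

End Moment.

(** * Orthogonal projections *)

Section Projection.
Context {R : realType} {n : nat}.
Implicit Types (P : 'M[R]_n) (x : 'rV[R]_n).

Definition is_proj P : Prop := P^T = P /\ P *m P = P.

(** For [x] of norm 2 in the image of [P], the projection onto the complement of [x] in that image;
    the factor 1/2 is the inverse of the norm. *)
Definition proj_compl P x : 'M[R]_n := P - 2^-1 *: (x^T *m x).

Lemma is_proj1 : is_proj 1%:M.
Proof. by split; rewrite ?trmx1 ?mulmx1. Qed.

Lemma is_proj_compl P x :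
  is_proj P -> x *m P = x -> inner x x = 2 -> is_proj (proj_compl P x).
Proof.
move=> [Ps PP] xP x2; rewrite /proj_compl; split.
  by rewrite linearB linearZ /= trmx_mul trmxK Ps.
have Px : P *m x^T = x^T by rewrite -{1}Ps -trmx_mul xP.
rewrite mulmxBl !mulmxBr PP -!scalemxAl -!scalemxAr mulmxA Px.
rewrite -(mulmxA x^T x P) xP -!(mulmxA x^T x) (mulmxA x x^T x) mulmx_inner x2.
rewrite mul_scalar_mx -scalemxAr !scalerA mulVf ?pnatr_eq0 // mulr1.
by rewrite subrr subr0.
Qed.

Lemma trace_proj_compl P x :
  inner x x = 2 -> \tr (proj_compl P x) = \tr P - 1.
Proof.
move=> x2; rewrite /proj_compl raddfB /= mxtraceZ mxtrace_mulC mulmx_inner x2.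
by rewrite mxtrace_scalar mulr1n mulVf ?pnatr_eq0.
Qed.

Lemma proj_complE P x y :
  y *m P = y -> inner y x = 0 -> y *m proj_compl P x = y.
Proof.
move=> yP y0; rewrite /proj_compl mulmxBr yP -scalemxAr mulmxA mulmx_inner y0.
by rewrite mul_scalar_mx scale0r scaler0 subr0.
Qed.

End Projection.

(** * Families of roots and bounds on their size *)

Lemma root_inner_cases (R : realType) n (x y : 'rV[R]_n) :
  inner x x = 2 -> inner y y = 2 -> inner x y \is a Num.int ->
  [\/ x = y, y = - x, inner x y = 1 | inner x y = 0 \/ inner x y = -1].
Proof.
move=> x2 y2 /intrP[m xyE].
(* These two norms bound the inner product by 2 in absolute value, and the extreme values make one
   of them vanish. *)
have := inner_ge0 (x - y); have := inner_ge0 (x + y).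
rewrite !innerE2 x2 y2 (innerC y) xyE => ge1 ge2.
have : -2 <= m <= 2.
  by apply/andP; split; rewrite -(ler_int R); lra.
move=> /andP[]; case: m xyE {ge1 ge2} => [[|[|[|m]]]|[|[|m]]] // xyE _ _.
- by apply: Or44; left.
- exact: Or43.
- apply: Or41; apply/subr0_eq/inner_eq0.
  by rewrite !innerE2 x2 y2 (innerC y) xyE; ring.
- by apply: Or44; right.
- apply: Or42; apply/esym/addr0_eq/inner_eq0.
  by rewrite !innerE2 x2 y2 (innerC y) xyE; ring.
Qed.

Lemma sum_eq_le1 (R : realType) (T : finType) (V : eqType) (u : T -> V)
    (K : {pred T}) x :
  injective u -> \sum_(j in K) (u j == x)%:R <= 1 :> R.
Proof.
move=> uI; rewrite -natr_sum -[1]/(1%:R) ler_nat -big_mkcondr sum1dep_card.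
apply/card_le1_eqP => i j; rewrite !inE => /andP[_ /eqP ix] /andP[_ /eqP jx].
by apply: uI; rewrite ix jx.
Qed.

Section RootFamily.
Context {R : realType} {n : nat} {T : finType}.
Implicit Types (u : T -> 'rV[R]_n) (P : 'M[R]_n) (x y : 'rV[R]_n).

Definition root_family u : Prop :=
  [/\ injective u, forall i, inner (u i) (u i) = 2
    & forall i j, inner (u i) (u j) \is a Num.int].

Definition inner1 u x : {pred T} := [pred j | inner x (u j) == 1].

Section Inner1.
Variables (u : T -> 'rV[R]_n) (P : 'M[R]_n) (x : 'rV[R]_n).
Hypotheses (uR : root_family u) (PP : is_proj P) (uP : forall i, u i *m P = u i)
  (xP : x *m P = x) (x2 : inner x x = 2).
Let K := inner1 u x.
Let v i := u i - 2^-1 *: x.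
Let k : R := #|K|%:R.

Let v_inner i j : i \in K -> j \in K -> inner (v i) (v j) = inner (u i) (u j) - 2^-1.
Proof.
rewrite !inE => /eqP xi /eqP xj; rewrite /v !innerE2 (innerC _ x) xi xj x2.
by field.
Qed.

(** In each row the terms are 1/4, except 9/4 when [u j] is [u i] or its antipode [x - u i]; each
    exception occurs at most once. *)
Let sum_v : \sum_(i in K) \sum_(j in K) inner (v i) (v j) ^+ 2 <= k * (k / 4 + 4).
Proof.
have [uI u2 uZ] := uR.
have -> : k * (k / 4 + 4) = \sum_(i in K) (k / 4 + 4).
  by rewrite sumr_const mulr_natl.
apply: ler_sum => i iK; have := sum_eq_le1 R K (u i) uI; have := sum_eq_le1 R K (x - u i) uI.
set s1 := \sum_(j in K) _; set s2 := \sum_(j in K) _ => s1le s2le.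
apply: (@le_trans _ _ (\sum_(j in K) (4^-1 + 2 * (u j == x - u i)%:R
   + 2 * (u j == u i)%:R))); last first.
  rewrite !big_split /= -!mulr_sumr -/s1 -/s2 sumr_const -mulr_natl -/k.
  by lra.
apply: ler_sum => j jK; rewrite v_inner //.
have b0 (b : bool) : 0 <= b%:R :> R by rewrite ler0n.
have := b0 (u j == x - u i); have := b0 (u j == u i).
move: (iK) (jK); rewrite !inE => /eqP xi /eqP xj.
case: (root_inner_cases (u2 i) (u2 j) (uZ i j)) => [ij|ij|->|[->|ij]].
- by rewrite -ij u2 eqxx /= => ? ?; lra.
- by move: xj; rewrite ij innerNr xi; lra.
- by lra.
- by lra.
- rewrite ij; have -> : u j = x - u i.
    apply/subr0_eq/inner_eq0.
    by rewrite !innerE2 !(innerC _ x) (innerC (u j) (u i)) ij xi xj x2 !u2; ring.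
  by rewrite eqxx /=; lra.
Qed.

Let sum_v_norm : \sum_(i in K) inner (v i) (v i) = 3 / 2 * k.
Proof.
rewrite mulr_natr -sumr_const; apply: eq_bigr => i iK; rewrite v_inner //.
by have [_ -> _] := uR; field.
Qed.

(* The vectors u i - x/2 have norm 3/2 and, apart from antipodal pairs
   u i + u j = x, inner products ±1/2: this is the relative bound for
   equiangular lines with angle 1/3 in dimension d. *)
Lemma card_inner1 (d : R) : \tr P = d + 1 -> 0 < d -> k * (9 - d) <= 16 * d.
Proof.
move=> trP d0.
have [Ps' PP'] := is_proj_compl PP xP x2.
have vP i : i \in K -> v i *m proj_compl P x = v i.
  rewrite inE => /eqP xi; apply: proj_complE.
    by rewrite /v mulmxBl uP -scalemxAl xP.
  by rewrite /v innerBl innerZl x2 innerC xi; field.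
(* The best coefficient: total norm [3 * k / 2] over the rank [d] of the complement of [x]. *)
have := frob_ge0 (moment_mx K v - (3 * k / (2 * d)) *: proj_compl P x).
rewrite moment_frob // trace_proj_compl // trP.
rewrite sum_v_norm => ge0.
have [->|kn0] := eqVneq k 0; first by rewrite mul0r; lra.
have k0 : 0 < k by rewrite lt_neqAle eq_sym kn0 ler0n.
have {}ge0 : 0 <= k * (k / 4 + 4) - 9 * k ^+ 2 / (4 * d).
  apply: le_trans ge0 _; rewrite -subr_ge0; move: sum_v; rewrite -subr_ge0.
  congr (0 <= _); field; lra.
have : 0 <= (k * (k / 4 + 4) - 9 * k ^+ 2 / (4 * d)) * (4 * d / k).
  by apply: mulr_ge0 => //; apply: divr_ge0; lra.
have -> : (k * (k / 4 + 4) - 9 * k ^+ 2 / (4 * d)) * (4 * d / k)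
   = 16 * d - k * (9 - d) by field; lra.
lra.
Qed.

(** The bound of [card_inner1] is attained for [d = 6] and [k = 32], so the moment matrix of the
    [v i] is 8 times the projection, where 8 = 3 * 32 / (2 * 6). A vector [y] orthogonal to [x]
    pairs with [v j] as it does with [u j]. *)
Lemma inner1_tight y : \tr P = 7 -> k = 32 -> y *m P = y -> inner x y = 0 ->
  \sum_(j in K) inner y (u j) ^+ 2 = 8 * inner y y.
Proof.
move=> trP k32 yP xy0.
have [Ps' PP'] := is_proj_compl PP xP x2.
have vP i : i \in K -> v i *m proj_compl P x = v i.
  rewrite inE => /eqP xi; apply: proj_complE.
    by rewrite /v mulmxBl uP -scalemxAl xP.
  by rewrite /v innerBl innerZl x2 innerC xi; field.
have frob0 : moment_mx K v - 8 *: proj_compl P x = 0.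
  apply: frob_eq0; apply/eqP; rewrite eq_le frob_ge0 andbT.
  rewrite moment_frob // trace_proj_compl // trP.
  by move: sum_v; rewrite sum_v_norm k32; lra.
have := inner_moment_mx K v y y; rewrite (subr0_eq frob0) -scalemxAr innerZl.
rewrite proj_complE // 1?innerC // => ->; apply: eq_bigr => j _.
by rewrite /v !innerBr !innerZr (innerC y x) xy0 mulr0 subr0 expr2.
Qed.

End Inner1.

Section Rank7.
Variables (u : T -> 'rV[R]_n) (P : 'M[R]_n).
Hypotheses (uR : root_family u) (PP : is_proj P) (uP : forall i, u i *m P = u i)
  (trP : \tr P = 7).

Lemma card_inner1_rank7 x : x *m P = x -> inner x x = 2 -> #|inner1 u x|%:R <= 32 :> R.
Proof.
move=> xP x2; have := @card_inner1 u P x uR PP uP xP x2 6.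
rewrite trP; lra.
Qed.

Let row_le i : \sum_j inner (u i) (u j) ^+ 2
  <= 8 + #|inner1 u (u i)|%:R + #|inner1 u (- u i)|%:R.
Proof.
have [uI u2 uZ] := uR.
have := sum_eq_le1 R predT (u i) uI; have := sum_eq_le1 R predT (- u i) uI.
set s1 := \sum_(j in _) _; set s2 := \sum_(j in _) _ => s1le s2le.
apply: (@le_trans _ _ (\sum_j (4 * (u j == u i)%:R
   + 4 * (u j == - u i)%:R + (j \in inner1 u (u i))%:R
   + (j \in inner1 u (- u i))%:R))); last first.
  rewrite !big_split /= -!mulr_sumr -/s1 -/s2 -!natr_sum -!big_mkcond !sum1_card.
  by lra.
apply: ler_sum => j _.
have b0 (b : bool) : 0 <= b%:R :> R by rewrite ler0n.
have := b0 (u j == u i); have := b0 (u j == - u i).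
have := b0 (j \in inner1 u (u i)); have := b0 (j \in inner1 u (- u i)).
rewrite !inE.
case: (root_inner_cases (u2 i) (u2 j) (uZ i j)) => [ij|ij|ij|[ij|ij]].
- by rewrite -ij u2 eqxx /= => ? ?; lra.
- have e : inner (u i) (u j) = -2 by rewrite ij innerNr u2.
  by rewrite e ij eqxx /= => ? ? ? ?; lra.
- by rewrite ij eqxx /= => ? ? ? ?; lra.
- by rewrite ij => ? ? ? ?; lra.
- by rewrite innerNl ij opprK eqxx /= => ? ? ? ?; lra.
Qed.

(** 72 = 8 + 32 + 32. The bound 32 is also applied to [- u i], which need not belong to the
    family. *)
Let row_le72 i : \sum_j inner (u i) (u j) ^+ 2 <= 72.
Proof.
have [_ u2 _] := uR; have := row_le i.
have := card_inner1_rank7 (uP i) (u2 i).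
have := @card_inner1_rank7 (- u i).
by rewrite mulNmx uP !innerE2 opprK u2 => /(_ erefl erefl); lra.
Qed.

Let gram_ge : 4 * #|T|%:R ^+ 2 / 7
  <= \sum_i \sum_j inner (u i) (u j) ^+ 2.
Proof.
have [Ps PP'] := PP.
have := frob_ge0 (moment_mx predT u - (2 * #|T|%:R / 7) *: P).
rewrite moment_frob // trP.
have -> : \sum_(i in predT) inner (u i) (u i) = #|T|%:R * 2.
  rewrite mulr_natl -sumr_const; apply: eq_bigr => i _.
  by have [_ -> _] := uR.
have -> : \sum_(i in predT) \sum_(j in predT) inner (u i) (u j) ^+ 2
   = \sum_i \sum_j inner (u i) (u j) ^+ 2.
  by apply: eq_big => // i _; apply: eq_bigl.
lra.
Qed.

(** The two estimates of the sum of squares give 4 N^2 / 7 <= 72 N. *)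
Lemma root_family_card : (#|T| <= 126)%N.
Proof.
have : \sum_i \sum_j inner (u i) (u j) ^+ 2 <= #|T|%:R * 72.
  by rewrite mulr_natl -sumr_const; apply: ler_sum => i _; apply: row_le72.
move/(le_trans gram_ge); set N : R := _%:R => le.
rewrite -(ler_nat R) -/N; have N0 : 0 <= N by rewrite ler0n.
nra.
Qed.

(** For N = 126 the lower bound 4 N^2 / 7 equals the upper bound 72 N, so no row can fall below
    72. *)
Lemma root_family_row i : #|T| = 126%N -> \sum_j inner (u i) (u j) ^+ 2 = 72.
Proof.
move=> T126; have := gram_ge; rewrite T126.
have sum72 : \sum_(i : T) 72 = 126 * 72 :> R.
  by rewrite sumr_const [RHS]mulr_natl -T126.
have pos j : true -> 0 <= 72 - \sum_k inner (u j) (u k) ^+ 2.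
  by rewrite subr_ge0.
move=> ge; have : \sum_j (72 - \sum_k inner (u j) (u k) ^+ 2) = 0.
  apply/eqP; rewrite eq_le sumr_ge0 // andbT big_split /= sumrN sum72; lra.
by move=> /(psumr_eq0P pos) /(_ i isT) /subr0_eq.
Qed.

Lemma root_family_inner1 i : #|T| = 126%N -> #|inner1 u (u i)|%:R = 32 :> R.
Proof.
move=> T126; have [_ u2 _] := uR.
have := row_le i; rewrite root_family_row //.
have := card_inner1_rank7 (uP i) (u2 i).
have := @card_inner1_rank7 (- u i).
rewrite mulNmx uP !innerE2 opprK u2 => /(_ erefl erefl); lra.
Qed.

End Rank7.
End RootFamily.

(** * Independence of outer products in the symmetric square *)

Section LinearIndependence.
Context {R : realType} {n : nat} {T : finType}.
Variables (v : T -> 'rV[R]_n) (h : 'rV[R]_n).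
Hypotheses (v2 : forall i, inner (v i) (v i) = 2)
  (v01 : forall i j, i != j -> inner (v i) (v j) = 0 \/ inner (v i) (v j) = 1)
  (hh : inner h h = 5 / 2) (hv : forall i, inner h (v i) = 1).

(* Pairing the relation with v j (x) v j, where (v j, v i)^2 = (v j, v i) off the
   diagonal, expresses c j linearly; positivity then kills c and w. *)
Lemma outer_products_free (c : T -> R) (w : 'rV[R]_n) :
  \sum_i c i *: ((v i)^T *m v i) = h^T *m w + w^T *m h ->
  (forall i, c i = 0) /\ w = 0.
Proof.
move=> cw.
have bil x y : \sum_i c i * (inner x (v i) * inner y (v i))
    = inner x h * inner y w + inner x w * inner y h.
  have := congr1 (fun M => inner (x *m M) y) cw => /=.
  rewrite mulmx_sumr inner_suml mulmxDr innerDl !inner_outer (innerC w) (innerC h).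
  move=> <-; apply: eq_bigr => i _.
  by rewrite -scalemxAr innerZl inner_outer (innerC y).
set m := \sum_i c i *: v i.
have innerm y : inner y m = \sum_i c i * inner y (v i).
  by rewrite innerC inner_suml; apply: eq_bigr => i _; rewrite innerZl innerC.
(* Contract the relation with [h], which has inner product 1 with every [v i]. *)
have mE : m = (5 / 2) *: w + inner h w *: h.
  apply/subr0_eq/inner_eq0; set y := m - _.
  rewrite {2}/y innerBr innerm innerDr !innerZr.
  have := bil h y; rewrite hh => bily.
  rewrite (eq_bigr (fun i => c i * (inner h (v i) * inner y (v i)))).
    by rewrite bily; ring.
  by move=> i _; rewrite hv mul1r.
have cj j : inner (v j) m + 2 * c j = 2 * inner (v j) w.
  have := bil (v j) (v j); rewrite (innerC _ h) hv mul1r mulr1 => e.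
  have -> : 2 * inner (v j) w = inner (v j) w + inner (v j) w by ring.
  rewrite -{}e innerm (bigD1 j) //= [in RHS](bigD1 j) //= v2.
  have -> : \sum_(i | i != j) c i * (inner (v j) (v i) * inner (v j) (v i))
    = \sum_(i | i != j) c i * inner (v j) (v i).
    apply: eq_bigr => i; rewrite eq_sym => /v01[] ->; ring.
  ring.
have norm_m : inner m m + 2 * (\sum_j c j ^+ 2) = 2 * inner m w.
  rewrite {1}/m inner_suml [in RHS]/m inner_suml !mulr_sumr -big_split /=.
  apply: eq_bigr => j _; rewrite !innerZl.
  by rewrite [RHS]mulrCA -cj; ring.
have cge0 : 0 <= \sum_j c j ^+ 2 by apply: sumr_ge0 => j _; apply: sqr_ge0.
have wge0 := inner_ge0 w.
have hw0 : 0 <= inner h w ^+ 2 by apply: sqr_ge0.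
(* Substituting [mE] into [norm_m] leaves only nonnegative terms. The last one arises with
   coefficient 11/2; the smaller 3 suffices. *)
have E : 2 * (\sum_j c j ^+ 2) + 5 / 4 * inner w w + 3 * inner h w ^+ 2 = 0.
  by have := norm_m; rewrite mE !innerE2 hh (innerC w h) => e; lra.
have w0 : inner w w = 0 by lra.
have : \sum_j c j ^+ 2 = 0 by lra.
move/psumr_eq0P => c0; split; last exact: inner_eq0.
move=> i; apply/eqP; rewrite -sqrf_eq0; apply/eqP/c0 => // j _.
exact: sqr_ge0.
Qed.

Lemma card_inner01 :
  (#|T| + n <= #|{: {p : 'I_n * 'I_n | (p.1 <= p.2)%N}}|)%N.
Proof.
pose S := {: {p : 'I_n * 'I_n | (p.1 <= p.2)%N}}; rewrite -/S.
(* The columns are the upper triangular coordinates of a symmetric matrix. The upper rows are the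
   squares of the [v i], the lower rows minus the symmetrized products of [h] with the basis
   vectors, so a relation between rows is exactly the hypothesis of [outer_products_free]. *)
pose A : 'M[R]_(#|T| + n, #|S|) := col_mx
  (\matrix_(i, s) (v (enum_val i) 0 (val (enum_val s)).1
     * v (enum_val i) 0 (val (enum_val s)).2))
  (\matrix_(l, s) - (h 0 (val (enum_val s)).1 * (l == (val (enum_val s)).2)%:R
     + h 0 (val (enum_val s)).2 * (l == (val (enum_val s)).1)%:R)).
suff /eqP freeA : row_free A by rewrite -freeA; apply: rank_leq_col.
rewrite -kermx_eq0; apply/eqP/row_matrixP => i0; rewrite row0.
set z := row i0 _.
have : z *m A = 0 by rewrite /z -row_mul mulmx_ker row0.
rewrite -[z]hsubmxK mul_row_col; move: (lsubmx z) (rsubmx z) => c w zA.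
have cw (a b : 'I_n) : (a <= b)%N -> \sum_i c 0 (enum_rank i) * (v i 0 a * v i 0 b)
   = h 0 a * w 0 b + h 0 b * w 0 a.
  move=> ab; pose s : S := exist _ (a, b) ab.
  have /rowP /(_ (enum_rank s)) := zA; rewrite !mxE => /eqP; rewrite addr_eq0.
  rewrite (reindex enum_rank) /=; last exact/onW_bij/enum_rank_bij.
  under eq_bigr do rewrite mxE !enum_rankK /=.
  move=> /eqP ->; rewrite -sumrN.
  under eq_bigr do rewrite mxE enum_rankK /= mulrN opprK mulrDr.
  have sumw (x : R) d : \sum_j w 0 j * (x * (j == d)%:R) = x * w 0 d.
    rewrite (bigD1 d) //= eqxx mulr1 mulrC big1 ?addr0 // => j /negPf ->.
    by rewrite !mulr0.
  by rewrite big_split /= !sumw.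
have [c0 w0] : (forall i, c 0 (enum_rank i) = 0) /\ w = 0.
  apply: outer_products_free; apply/matrixP => a b.
  have mxE' (x y : 'rV[R]_n) : (x^T *m y) a b = x 0 a * y 0 b.
    by rewrite mxE big_ord1 mxE.
  rewrite summxE mxE !mxE'; under eq_bigr do rewrite mxE mxE'.
  have [/cw->|/ltnW/cw] := leqP a b; first by rewrite (mulrC (w 0 a)).
  under eq_bigr => i _ do rewrite [_ * v i 0 b]mulrC.
  by move=> ->; rewrite addrC (mulrC (w 0 a)).
suff -> : c = 0 by rewrite w0 row_mx0.
by apply/rowP => j; rewrite mxE -(enum_valK j) c0.
Qed.

End LinearIndependence.

Lemma card_inner01_dim8 (R : realType) (T : finType) (v : T -> 'rV[R]_8) h :
  (forall i, inner (v i) (v i) = 2) ->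
  (forall i j, i != j -> inner (v i) (v j) = 0 \/ inner (v i) (v j) = 1) ->
  inner h h = 5 / 2 -> (forall i, inner h (v i) = 1) -> (#|T| <= 28)%N.
Proof.
move=> v2 v01 hh hv; have := card_inner01 v2 v01 hh hv.
suff -> : #|{: {p : 'I_8 * 'I_8 | (p.1 <= p.2)%N}}| = 36%N.
  by rewrite -[36%N]/(28 + 8)%N leq_add2r.
rewrite card_sig -sum1_card.
rewrite -(pair_big_dep xpredT (fun i j : 'I_8 => (i <= j)%N) (fun _ _ => 1%N)) /=.
under eq_bigr do rewrite big_mkcond /=.
by rewrite !(big_ord_recl, big_ord0).
Qed.

(** * Biangular families without a pole *)

Lemma biangular_inner01 (R : realType) (x : R) (a b : bool) :
  [\/ x = 2, x = -2, x = 6 | x = -6] -> x <> -2 * (-1) ^+ a * (-1) ^+ b ->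
  let y := 4^-1 * (-2 + (-1) ^+ a * (-1) ^+ b * x) in
  y <> -2 -> y = 0 \/ y = 1.
Proof.
case=> -> /=; case: a; case: b; rewrite ?expr0 ?expr1 => ne1 ne2.
all: first [by left; lra | by right; lra | by case: ne1; lra | by case: ne2; lra].
Qed.

Section Biangular.
Context {R : realType} {T : finType}.

Definition biangular (w : T -> 'rV[R]_8) : Prop :=
  (forall i, inner (w i) (w i) = 10) /\
  (forall i j, i != j -> [\/ inner (w i) (w j) = 2, inner (w i) (w j) = -2,
      inner (w i) (w j) = 6 | inner (w i) (w j) = -6]).

Variable w : T -> 'rV[R]_8.
Hypothesis wB : biangular w.

(** The congruence class of 2 modulo 4 contains all inner products 10, ±2, ±6 and is stable under
    signed sums of three terms. *)
Let mod4 (x : R) := exists a : int, x = 4 * a%:~R + 2.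

Let mod4_inner i j : mod4 (inner (w i) (w j)).
Proof.
have [w10 wij] := wB; have [->|/wij[]->] := eqVneq i j; rewrite ?w10.
- by exists 2; ring.
- by exists 0; ring.
- by exists (-1); ring.
- by exists 1; ring.
- by exists (-2); ring.
Qed.

Let mod4_sum x y z (a b : bool) : mod4 x -> mod4 y -> mod4 z ->
  mod4 ((-1) ^+ a * x + (-1) ^+ b * y - z).
Proof.
have mod4_sign c (e : bool) : mod4 c -> mod4 ((-1) ^+ e * c).
  case=> m ->; case: e; rewrite ?expr0 ?expr1; last by exists m; ring.
  by exists (- m - 1); rewrite rmorphB rmorphN /=; ring.
move=> /(mod4_sign _ a)[k ->] /(mod4_sign _ b)[l ->] [m ->].
by exists (k + l - m); rewrite rmorphB rmorphD /=; ring.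
Qed.

(** The pole is a signed sum of the three vectors, of norm 30 + 2 (-2 - 6 - 6) = 2. Its inner
    products with the family are 2 modulo 4, and Cauchy-Schwarz bounds their squares by 20, which
    leaves ±2. *)
Lemma biangular_pole i j l (a b : bool) :
  inner (w i) (w j) = 6 * (-1) ^+ a -> inner (w i) (w l) = 6 * (-1) ^+ b ->
  inner (w j) (w l) = -2 * (-1) ^+ a * (-1) ^+ b ->
  exists r, inner r r = 2 /\ forall m, inner r (w m) = 2 \/ inner r (w m) = -2.
Proof.
have [w10 _] := wB => ij il jl.
pose r := (-1) ^+ a *: w j + (-1) ^+ b *: w l - w i.
have r2 : inner r r = 2.
  rewrite /r !innerE2 !w10 !(innerC _ (w i)) (innerC (w l)) ij il jl.
  by case: (a); case: (b); rewrite ?expr0 ?expr1; ring.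
have rw m : mod4 (inner r (w m)) by rewrite /r !innerE2; apply: mod4_sum.
move: r r2 rw => r r2 rw; exists r; split=> // m; have [c rc] := rw m.
have := inner_ge0 (10 *: r - inner r (w m) *: w m).
rewrite !innerE2 r2 w10 (innerC (w m)) rc => le.
have {}le : c ^+ 2 + c <= 1 by rewrite -(ler_int R) rmorphD rmorphXn /=; lra.
have [->|->] : c = 0 \/ c = -1 by nia.
  by left; rewrite mulr0 add0r.
by right; rewrite rmorphN /=; ring.
Qed.

Hypothesis no_pole : ~ exists r,
  inner r r = 2 /\ forall m, inner r (w m) = 2 \/ inner r (w m) = -2.

Let K i : {pred T} := [pred j | (inner (w i) (w j) == 6) || (inner (w i) (w j) == -6)].

Let card_K i : (#|K i| <= 28)%N.
Proof.
have [w10 wij] := wB.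
pose e j := inner (w i) (w j) == -6.
have eE j : j \in K i -> inner (w i) (w j) = 6 * (-1) ^+ e j.
  rewrite inE /e => /orP[]/eqP ->; rewrite ?eqxx ?expr1; last by ring.
  by rewrite (_ : 6 == -6 = false) ?expr0 ?mulr1 //; apply/eqP; lra.
pose v (s : {j | j \in K i}) := 2^-1 *: (w i - (-1) ^+ e (val s) *: w (val s)).
have hv s : inner (2^-1 *: w i) (v s) = 1.
  by rewrite /v !innerE2 w10 eE ?(valP s) //; case: (e _); rewrite ?expr0 ?expr1; field.
have hh : inner (2^-1 *: w i) (2^-1 *: w i) = 5 / 2.
  by rewrite !innerE2 w10; field.
have v2 s : inner (v s) (v s) = 2.
  rewrite /v !innerE2 !w10 (innerC _ (w i)) eE ?(valP s) //.
  by case: (e _); rewrite ?expr0 ?expr1; field.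
have <- : #|{: {j | j \in K i}}| = #|K i| by rewrite card_sig.
apply: (card_inner01_dim8 v2 _ hh hv) => s t st.
have vst : inner (v s) (v t) = 4^-1 * (-2 +
    (-1) ^+ e (val s) * (-1) ^+ e (val t) * inner (w (val s)) (w (val t))).
  rewrite /v !innerE2 !w10 (innerC _ (w i)) !eE ?(valP s) ?(valP t) //.
  by do 2 case: (e _); rewrite ?expr0 ?expr1; field.
(* A priori the inner product of [v s] and [v t] is -2, -1, 0 or 1. The value -2 would make them
   opposite, although both have inner product 1 with [2^-1 *: w i]. *)
have ne2 : inner (v s) (v t) <> -2.
  move=> vst2; have vst0 : v s + v t = 0.
    by apply: inner_eq0; rewrite !(innerDl, innerDr) !v2 (innerC (v t)) vst2; ring.
  have := innerDr (2^-1 *: w i) (v s) (v t).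
  by rewrite vst0 !hv innerC inner0l => /esym/eqP; rewrite -mulr2n pnatr_eq0.
(* This is the case of inner product -1 between [v s] and [v t], which would yield a pole. *)
have ne1 : inner (w (val s)) (w (val t)) <> -2 * (-1) ^+ e (val s) * (-1) ^+ e (val t).
  by move=> ip; apply: no_pole; apply: biangular_pole ip; apply: eE; apply: valP.
have := wij (val s) (val t); rewrite (inj_eq val_inj) st => /(_ isT) ip.
by rewrite vst; apply: biangular_inner01 ip ne1 _; rewrite -vst.
Qed.

(** A row of squares is at most 4 N + 96 + 32 * 28 = 4 N + 992, where 96 = 100 - 4 and 32 = 36 - 4.
    The second moment gives at least 100 N^2 / 8 in total, so 8.5 N <= 992. *)
Lemma biangular_no_pole : (#|T| <= 116)%N.
Proof.
have [w10 wij] := wB.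
have := frob_ge0 (moment_mx predT w - (10 * #|T|%:R / 8) *: 1%:M).
rewrite moment_frob ?trmx1 ?mulmx1 //; last by move=> i _; rewrite mulmx1.
have -> : \sum_(i in predT) inner (w i) (w i) = #|T|%:R * 10.
  by rewrite mulr_natl -sumr_const; apply: eq_bigr => i _.
rewrite mxtrace1.
have : \sum_(i in predT) \sum_(j in predT) inner (w i) (w j) ^+ 2
   <= #|T|%:R * (4 * #|T|%:R + 992).
  rewrite mulr_natl -sumr_const; apply: ler_sum => i _.
  apply: (@le_trans _ _ (\sum_(j in predT) (4 + 96 * (j == i)%:R + 32 * (j \in K i)%:R))).
    apply: ler_sum => j _; rewrite inE; have [->|/wij ij] := eqVneq j i.
      by rewrite w10 /=; case: (_ || _) => /=; lra.
    move: ij; rewrite (innerC (w j)).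
    by case=> ->; rewrite ?eqxx ?orbT /=; first [lra | case: (_ || _) => /=; lra].
  have Ki : #|K i|%:R <= 28 :> R by rewrite (ler_nat R _ 28) card_K.
  have ii := sum_eq_le1 R predT i (@inj_id T).
  rewrite 2!big_split /= -!mulr_sumr.
  rewrite sumr_const -[4 *+ _]mulr_natr.
  have -> : \sum_(j in predT) (j \in K i)%:R = #|K i|%:R :> R.
    by rewrite -natr_sum -big_mkcond sum1_card.
  by lra.
set N := _%:R => le1 le2; rewrite -ltnS -(ltr_nat R) -/N.
have N0 : 0 <= N by rewrite ler0n.
by nra.
Qed.

End Biangular.

(** * The Gram matrix of a pole and a basis of E_7 *)

(* Gram matrix of vectors r, p, q, t1, t2, t3, t4, s where r is a root of E_8
   and the other seven form a basis of the E_7 orthogonal to it. In an orthonormal basis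
   f1, ..., f8 one may take r = f7 - f8, p = f5 + f6, q = f5 - f6, tk = f5 + fk
   and s = (f1 + ... + f8)/2. *)
Definition gram_table : seq (seq int) :=
  [:: [:: 2; 0; 0; 0; 0; 0; 0; 0];
      [:: 0; 2; 0; 1; 1; 1; 1; 1];
      [:: 0; 0; 2; 1; 1; 1; 1; 0];
      [:: 0; 1; 1; 2; 1; 1; 1; 1];
      [:: 0; 1; 1; 1; 2; 1; 1; 1];
      [:: 0; 1; 1; 1; 1; 2; 1; 1];
      [:: 0; 1; 1; 1; 1; 1; 2; 1];
      [:: 0; 1; 0; 1; 1; 1; 1; 2]].

(** Half of what remains of twice the inverse of [gram] once the squares of [parity_row] and
    [pole_row] are removed. *)
Definition half_table : seq (seq int) :=
  [:: [:: 0; 0; 0; 0; 0; 0; 0; 0];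
      [:: 0; 2; 2; -1; -1; -1; -1; 1];
      [:: 0; 2; 3; -2; -2; -2; -2; 2];
      [:: 0; -1; -2; 1; 0; 0; 0; -1];
      [:: 0; -1; -2; 0; 1; 0; 0; -1];
      [:: 0; -1; -2; 0; 0; 1; 0; -1];
      [:: 0; -1; -2; 0; 0; 0; 1; -1];
      [:: 0; 1; 2; -1; -1; -1; -1; 2]].

Definition table_mx (t : seq (seq int)) : 'M[int]_8 :=
  \matrix_(k, l) nth 0 (nth [::] t k) l.

Definition gram : 'M[int]_8 := table_mx gram_table.

(** Applied to the inner products of a dual vector with the frame, it gives modulo 2 the class of
    that vector in the discriminant group of E_7, of order 2. *)
Definition parity_row : 'rV[int]_8 := \row_k nth 0 [:: 0; 0; 1; 1; 1; 1; 1; 0] k.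

Definition pole_row : 'rV[int]_8 := delta_mx 0 0.

Definition twice_inv_gram : 'M[int]_8 :=
  parity_row^T *m parity_row + pole_row^T *m pole_row + 2 *: table_mx half_table.

Lemma gram_twice_inv : gram *m twice_inv_gram = 2%:M.
Proof.
have E (k l : 'I_8) : twice_inv_gram k l =
  parity_row 0 k * parity_row 0 l + (k == 0%N :> nat)%:R * (l == 0%N :> nat)%:R
  + 2 * nth 0 (nth [::] half_table k) l.
  by rewrite !mxE !big_ord1 !mxE.
apply/matrixP => k l; rewrite !mxE; under eq_bigr do rewrite E !mxE.
rewrite !big_ord_recl big_ord0 /=.
rewrite -(inj_eq val_inj) /=.
case: k => [[|[|[|[|[|[|[|[|k]]]]]]]] kP] //;
  by case: l => [[|[|[|[|[|[|[|[|l]]]]]]]] lP].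
Qed.

(** * Frames with the prescribed Gram matrix and their dual vectors *)

Section Frame.
Context {R : realType}.
Implicit Types (B Q : 'M[R]_8) (v : 'rV[R]_8).
Local Notation toR := (map_mx (intmul (1 : R))).

Definition is_frame B : Prop := B *m B^T = toR gram.

(** [v *m B^T] lists the inner products of [v] with the rows of [B], of which row 0 is the pole. So
    these are the norm 2 vectors in the dual of the copy of E_7 spanned by the other rows. *)
Definition frame_dual B v : Prop :=
  [/\ inner v v = 2, (v *m B^T) 0 0 = 0
    & forall k, (v *m B^T) 0 k \is a Num.int].

(** This expresses the inner product of any two vectors through their inner products with the
    frame. *)
Lemma frame_inv B : is_frame B -> B^T *m toR twice_inv_gram *m B = 2%:M.
Proof.
move=> BB.
have e : B *m (2^-1 *: (B^T *m toR twice_inv_gram)) = 1%:M.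
  rewrite -scalemxAr mulmxA BB -map_mxM gram_twice_inv map_scalar_mx /=.
  by rewrite -scalemx1 scalerA mulVf ?scale1r // pnatr_eq0.
move/mulmx1C: e; rewrite -scalemxAl => e; rewrite -scalemx1 -e scalerA mulfV ?scale1r //.
by rewrite pnatr_eq0.
Qed.

(* Modulo 2, twice the inverse Gram matrix is the sum of the squares of
   [parity_row] and [pole_row]. So a dual vector of norm 2 orthogonal to the pole
   pairs evenly with [parity_row], and two such vectors have an integral inner
   product. *)
Lemma frame_dual_int B v v' : is_frame B -> frame_dual B v -> frame_dual B v' ->
  inner v v' \is a Num.int.
Proof.
move=> BB [v2 v0 vZ] [v2' v0' vZ'].
have lift x : (forall k, (x *m B^T) 0 k \is a Num.int) -> exists b : 'rV[int]_8, x *m B^T = toR b.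
  move=> xZ; exists (\row_k Num.floor ((x *m B^T) 0 k)).
  by apply/rowP => k; rewrite [RHS]mxE [in RHS]mxE; apply/esym/eqP; rewrite -intrEfloor.
have [b bE] := lift v vZ; have [b' bE'] := lift v' vZ'.
have zero (c : 'rV[int]_8) : (toR c) 0 0 = 0 :> R -> c *m pole_row^T = 0.
  rewrite mxE => /eqP; rewrite intr_eq0 => /eqP c0.
  by apply/matrixP => i j; rewrite !ord1 trmx_delta -colE !mxE.
have := zero b; rewrite -bE => /(_ v0) b0; have := zero b'; rewrite -bE' => /(_ v0') b0'.
have pairing x y c d : x *m B^T = toR c -> y *m B^T = toR d ->
  2 * inner x y = ((c *m twice_inv_gram *m d^T) 0 0)%:~R.
  move=> xc yd; have := frame_inv BB => /(congr1 (fun M => x *m M *m y^T)).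
  rewrite !mulmxA xc mul_mx_scalar -scalemxAl (mulmx_inner x) -(mulmxA _ B).
  have -> : B *m y^T = (toR d)^T by rewrite -yd trmx_mul trmxK.
  rewrite map_trmx -!map_mxM => /matrixP/(_ 0 0).
  by rewrite [in X in X = _ -> _]mxE => ->; rewrite !mxE eqxx mulr1n.
pose par (c : 'rV[int]_8) := (c *m parity_row^T) 0 0.
have expand (c d : 'rV[int]_8) : c *m pole_row^T = 0 ->
   (c *m twice_inv_gram *m d^T) 0 0 =
   par c * par d + 2 * (c *m table_mx half_table *m d^T) 0 0.
  move=> c0; rewrite /twice_inv_gram !mulmxDr !mulmxDl -scalemxAr -scalemxAl.
  rewrite !mulmxA c0 mul0mx mul0mx addr0 mxE; congr (_ + _).
    rewrite /par -mulmxA mxE big_ord1; congr (_ * _).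
    by rewrite -[parity_row *m _]trmxK trmx_mul trmxK mxE.
  by rewrite mxE.
have even_par x c : inner x x = 2 -> x *m B^T = toR c -> c *m pole_row^T = 0 ->
    exists m, par c = 2 * m.
  move=> x2 xc c0; have := pairing x x c c xc xc.
  rewrite x2 expand //; set h := (_ *m c^T) 0 0.
  move=> /esym e4; have e : par c * par c + 2 * h = 4.
    by apply: (@intr_inj R); rewrite e4; ring.
  have [m [pE|pE]] : exists m, par c = 2 * m \/ par c = 2 * m + 1.
    by exists (par c %/ 2)%Z; lia.
  - by exists m.
  - by move: e; rewrite pE; clearbody h; move=> e; exfalso; lia.
have [m mE] := even_par v b v2 bE b0; have [m' mE'] := even_par v' b' v2' bE' b0'.
have := pairing v v' b b' bE bE'; rewrite expand // mE mE'.
set h := (_ *m b'^T) 0 0 => e; apply/intrP; exists (2 * m * m' + h).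
apply: (@mulfI _ 2); first by rewrite pnatr_eq0.
by rewrite e; ring.
Qed.

Lemma frame_isometry B B' : is_frame B -> is_frame B' ->
  exists Q, Q *m Q^T = 1%:M /\ B' = B *m Q.
Proof.
move=> BB BB'; set M := toR twice_inv_gram.
have two0 : 2 != 0 :> R by rewrite pnatr_eq0.
have GM : toR gram *m M = 2%:M by rewrite -map_mxM gram_twice_inv map_scalar_mx.
have MM : M^T = M.
  rewrite map_trmx; congr map_mx; rewrite /twice_inv_gram !linearD linearZ /=.
  rewrite !trmx_mul !trmxK; congr (_ + _ *: _); apply/matrixP => k l.
  rewrite !mxE; case: k => [[|[|[|[|[|[|[|[|k]]]]]]]] kP] //;
  by case: l => [[|[|[|[|[|[|[|[|l]]]]]]]] lP].
(* The product of the inverse of [B], which is half of [B^T *m M], with [B']. *)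
exists (2^-1 *: (B^T *m M *m B')); split; last first.
  rewrite -scalemxAr !mulmxA BB GM mul_scalar_mx scalerA mulVf //.
  by rewrite scale1r.
rewrite linearZ /= -scalemxAl -scalemxAr !trmx_mul trmxK MM.
rewrite !mulmxA -(mulmxA _ B') BB' -(mulmxA _ _ M) GM mul_mx_scalar.
rewrite -scalemxAl frame_inv // !scalerA scale_scalar_mx.
by congr (_%:M); field.
Qed.

End Frame.

(** * Finding a frame among 126 roots *)

Section FrameExistence.
Context {R : realType} {T : finType}.
Variables (u : T -> 'rV[R]_8) (r : 'rV[R]_8).
Hypotheses (T126 : #|T| = 126%N) (uR : root_family u) (r2 : inner r r = 2)
  (ur : forall i, inner (u i) r = 0).

Let P := proj_compl 1%:M r.

Let PP : is_proj P.
Proof. by apply: is_proj_compl; rewrite ?mulmx1 //; apply: is_proj1. Qed.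

Let perpP x : inner x r = 0 -> x *m P = x.
Proof. by move=> x0; apply: proj_complE; rewrite ?mulmx1. Qed.

Let uP i : u i *m P = u i.
Proof. exact: perpP. Qed.

Let trP : \tr P = 7.
Proof. by rewrite trace_proj_compl // mxtrace1; ring. Qed.

Let row72 i : \sum_j inner (u i) (u j) ^+ 2 = 72.
Proof. exact: (root_family_row uR PP uP). Qed.

Let K32 i : #|inner1 u (u i)|%:R = 32 :> R.
Proof. exact: (root_family_inner1 uR PP uP). Qed.

(** Otherwise all 126 squared inner products with [u i] would be at least 1, while they sum to
    72. *)
Lemma exists_orthogonal_root i : exists j, inner (u i) (u j) = 0.
Proof.
apply: contrapT => /forallNP ne0; have := row72 i.
have : \sum_(j : T) 1 <= \sum_j inner (u i) (u j) ^+ 2.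
  apply: ler_sum => j _; have [_ u2 uZ] := uR.
  case: (root_inner_cases (u2 i) (u2 j) (uZ i j)) => [ij|ij|ij|[/ne0 //|ij]].
  - by rewrite -ij u2; lra.
  - by rewrite ij innerNr u2; lra.
  - by rewrite ij; lra.
  - by rewrite ij; lra.
by rewrite sumr_const T126 => le e; move: le; rewrite e ler_nat.
Qed.

(* The tight frame identity [inner1_tight] at u q gives 16 of the 32 neighbours of
   u p inner product ±1 with u q, hence at least 7 of them with the same sign. *)
Lemma exists_D4_skeleton : exists (p q s : T) (e : bool),
  let q' := (-1) ^+ e *: u q in
  [/\ inner (u p) q' = 0, inner (u p) (u s) = 1, inner q' (u s) = 0
    & (7 <= #|[predI inner1 u (u p) & inner1 u q']|)%N].
Proof.
have [_ u2 uZ] := uR.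
have [p _] : exists p : T, true by apply/existsP; rewrite -[[exists _, _]]/(~~ pred0b _) -lt0n T126.
have [q pq] := exists_orthogonal_root p.
have := inner1_tight uR PP uP (uP p) (u2 p) trP (K32 p) (uP q) pq.
rewrite u2 => sum16.
have cases j : j \in inner1 u (u p) ->
  [\/ inner (u q) (u j) = 1, inner (u q) (u j) = 0 | inner (u q) (u j) = -1].
  rewrite inE => /eqP pj.
  case: (root_inner_cases (u2 q) (u2 j) (uZ q j)) => [qj|jq|->|[->|->]].
  - by move: pj; rewrite -qj pq; lra.
  - by move: pj; rewrite jq innerNr pq; lra.
  - exact: Or31.
  - exact: Or32.
  - exact: Or33.
(* If none of the 32 inner products vanished, their squares would sum to at least 32 instead of
   16. *)
have [s sK qs] : exists2 s, s \in inner1 u (u p) & inner (u q) (u s) = 0.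
  apply: contrapT => no; have : \sum_(j in inner1 u (u p)) 1
     <= \sum_(j in inner1 u (u p)) inner (u q) (u j) ^+ 2.
    apply: ler_sum => j jK; case: (cases j jK) => [->|qj|->]; [lra| |lra].
    by case: no; exists j.
  by rewrite sum16 sumr_const K32; lra.
pose A (e : bool) : {pred T} := [predI inner1 u (u p) & inner1 u ((-1) ^+ e *: u q)].
have cardA : #|A false|%:R + #|A true|%:R = 16 :> R.
  have -> : 16 = 8 * 2 :> R by ring.
  rewrite -sum16 -!sum1_card !natr_sum big_mkcond [X in _ + X]big_mkcond.
  rewrite -big_split [RHS]big_mkcond /=; apply: eq_bigr => j _.
  rewrite /A !inE; case: eqP => pj /=; last by rewrite addr0.
  have jK : j \in inner1 u (u p) by rewrite inE pj.
  rewrite expr0 expr1 !innerZl mul1r mulN1r.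
  case: (cases j jK) => [->|->|->]; rewrite ?eqxx.
  - by rewrite (_ : -1 == 1 = false) //; [lra | apply/eqP; lra].
  - by rewrite oppr0 eq_sym oner_eq0; lra.
  - by rewrite opprK eqxx (_ : -1 == 1 = false) //; [lra | apply/eqP; lra].
(* Seven suffice for four greedy choices: three chosen roots exclude at most six. *)
have [e Ae] : exists e, (7 <= #|A e|)%N.
  have [|lt] := leqP 7 #|A false|; first by exists false.
  exists true; move: cardA; rewrite -natrD => /eqP; rewrite eqr_nat => /eqP; lia.
exists p, q, s, e; split=> //.
- by rewrite innerZr pq mulr0.
- by move: sK; rewrite inE => /eqP.
- by rewrite innerZl qs mulr0.
Qed.

Section Greedy.
Variables x y : 'rV[R]_8.
Hypotheses (x2 : inner x x = 2) (y2 : inner y y = 2) (xy : inner x y = 0).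
Let A : {pred T} := [predI inner1 u x & inner1 u y].

(* The vectors u j - (x + y)/2 are unit vectors, any two of them equal, opposite
   or orthogonal. *)
Lemma inner_common j l : j \in A -> l \in A -> 
  [\/ u l = u j, u l = x + y - u j | inner (u j) (u l) = 1].
Proof.
rewrite !inE => /andP[/eqP xj /eqP yj] /andP[/eqP xl /eqP yl].
have [_ u2 uZ] := uR.
case: (root_inner_cases (u2 j) (u2 l) (uZ j l)) => [jl|jl|jl|[jl|jl]].
- exact: Or31.
- by move: xl; rewrite jl innerNr xj; lra.
- exact: Or33.
- apply: Or32; apply/subr0_eq/inner_eq0.
  rewrite !innerE2 !(innerC _ x) !(innerC _ y) (innerC (u l)) x2 y2 !u2.
  by rewrite xj xl yj yl jl (innerC y x) xy; ring.
- have := inner_ge0 (x + y - u j - u l).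
  rewrite !innerE2 !(innerC _ x) !(innerC _ y) (innerC (u l)) x2 y2 !u2.
  by rewrite xj xl yj yl jl (innerC y x) xy; lra.
Qed.

(** By [inner_common], each [j] in [L] excludes only [u j] and [x + y - u j]. *)
Lemma exists_common_root (L : seq T) : {subset L <= A} -> (2 * size L < #|A|)%N ->
  exists2 l, l \in A & forall j, j \in L -> inner (u j) (u l) = 1.
Proof.
move=> LA ltA; apply: contrapT => no.
have [uI _ _] := uR.
have sub : {subset map u (enum A) <= map u L ++ map (fun j => x + y - u j) L}.
  move=> v /mapP[l]; rewrite mem_enum => lA ->; apply: contraT => notin; case: no.
  exists l => [//|j jL]; have [lj|lj|//] := inner_common (LA _ jL) lA.
  - by move: notin; rewrite mem_cat lj map_f.
  - move: notin; rewrite mem_cat lj negb_or => /andP[_].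
    by rewrite (map_f (fun j => x + y - u j)).
have := uniq_leq_size _ sub; rewrite map_inj_uniq // enum_uniq => /(_ isT).
by rewrite size_cat !size_map -cardE addnn -mul2n leqNgt ltA.
Qed.

End Greedy.

Lemma exists_frame :
  exists B, [/\ is_frame B, row 0 B = r & forall i, frame_dual B (u i)].
Proof.
have [p [q [s [e [pq ps qs cardA]]]]] := exists_D4_skeleton.
have [_ u2 uZ] := uR.
set x := u p in pq ps cardA; set y := _ *: _ in pq qs cardA; set z := u s in ps qs.
have y2 : inner y y = 2 by rewrite /y innerZl innerZr u2 mulrA -expr2 sqrr_sign mul1r.
have yr : inner y r = 0 by rewrite /y innerZl ur mulr0.
have yZ i : inner y (u i) \is a Num.int by rewrite /y innerZl rpredM ?rpredX ?rpredN ?rpred1.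
move: y pq qs cardA y2 yr yZ => y pq qs cardA y2 yr yZ.
have x2 := u2 p; have z2 := u2 s; have xr := ur p; have zr := ur s.
rewrite -/x -/z in x2 z2 xr zr.
have xZ i : inner x (u i) \is a Num.int by apply: uZ.
have zZ i : inner z (u i) \is a Num.int by apply: uZ.
pose A : {pred T} := [predI inner1 u x & inner1 u y].
have ex := exists_common_root x2 y2 pq.
have [j1 A1 _] := ex [::] (fun _ => ltac:(done)) (leq_trans (isT : 0 < 7)%N cardA).
have [|| j2 A2 j12] := ex [:: j1]; [|exact: leq_trans cardA|].
  by move=> j; rewrite inE => /eqP ->.
have [|| j3 A3 j123] := ex [:: j1; j2]; [|exact: leq_trans cardA|].
  by move=> j; rewrite !inE => /orP[] /eqP ->.
have [|| j4 A4 j1234] := ex [:: j1; j2; j3]; [|exact: leq_trans cardA|].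
  by move=> j; rewrite !inE => /or3P[] /eqP ->.
have {j12} j12 : inner (u j1) (u j2) = 1 by apply: j12; rewrite !inE eqxx.
have j13 : inner (u j1) (u j3) = 1 by apply: j123; rewrite !inE eqxx.
have j23 : inner (u j2) (u j3) = 1 by apply: j123; rewrite !inE eqxx orbT.
have j14 : inner (u j1) (u j4) = 1 by apply: j1234; rewrite !inE eqxx.
have j24 : inner (u j2) (u j4) = 1 by apply: j1234; rewrite !inE eqxx orbT.
have j34 : inner (u j3) (u j4) = 1 by apply: j1234; rewrite !inE eqxx !orbT.
(* A common neighbour of [x] and [y] has inner product 0 or 1 with [z]. The map [x + y - u j]
   exchanges these values, since [x + y] has inner product 1 with [z], and preserves the other inner
   products of the frame. The image may lie outside the family, but it still has integral inner
   products with it. *)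
pose t j := if inner z (u j) == 1 then u j else x + y - u j.
have tP j : j \in A -> [/\ inner (t j) (t j) = 2, inner x (t j) = 1,
    inner y (t j) = 1, inner z (t j) = 1 & inner r (t j) = 0].
  rewrite !inE => /andP[/eqP xj /eqP yj]; rewrite /t (innerC r).
  case: eqP => [zj|zj].
    by split; rewrite ?u2 ?ur.
  have zj0 : inner z (u j) = 0.
    case: (root_inner_cases (u2 s) (u2 j) (uZ s j)) => // [sj|sj|[//|sj]].
    - by move: yj; rewrite -sj qs; lra.
    - by move: yj; rewrite sj innerNr qs; lra.
    (* Inner product -1 would give [z + u j = x], whose inner product with [y] is 1 on the left and
       0 on the right. *)
    - have zx : z + u j = x.
        apply/subr0_eq/inner_eq0.
        rewrite !innerE2 (innerC (u j) z) (innerC z x) (innerC (u j) x).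
        by rewrite z2 (sj : inner z (u j) = -1) u2 ps x2 xj; ring.
      by move: pq; rewrite -zx innerDl (innerC z) (innerC (u j)) qs yj; lra.
  split; rewrite !innerE2.
  - rewrite (innerC (u j) x) (innerC (u j) y) (innerC y x).
    by rewrite x2 y2 pq xj yj u2; ring.
  - by rewrite x2 pq xj; ring.
  - by rewrite (innerC y x) pq y2 yj; ring.
  - by rewrite (innerC z x) (innerC z y) ps qs zj0; ring.
  - by rewrite xr yr ur; ring.
have tt j l : j \in A -> l \in A -> inner (u j) (u l) = 1 -> inner (t j) (t l) = 1.
  rewrite !inE => /andP[/eqP xj /eqP yj] /andP[/eqP xl /eqP yl] jl; rewrite /t.
  case: ifP => _; case: ifP => _ //; rewrite !innerE2.
  - by rewrite (innerC (u j) x) (innerC (u j) y) xj yj jl; ring.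
  - by rewrite xl yl jl; ring.
  - rewrite (innerC (u j) x) (innerC (u j) y) (innerC y x).
    by rewrite x2 y2 pq xj yj xl yl jl; ring.
have tZ j i : inner (t j) (u i) \is a Num.int.
  by rewrite /t; case: ifP => _ //; rewrite !innerE2 rpredB ?rpredD.
pose rows := [:: r; x; y; t j1; t j2; t j3; t j4; z].
pose B : 'M[R]_8 := \matrix_(k < 8) nth 0 rows k.
have BE v k : (v *m B^T) 0 k = inner v (nth 0 rows k).
  by rewrite mxE; apply: eq_bigr => l _; rewrite !mxE.
have rowB k : row k B = nth 0 rows k by rewrite rowK.
exists B; split; [|exact: rowB|].
  apply/matrixP => k l.
  have -> : (B *m B^T) k l = inner (nth 0 rows k) (nth 0 rows l).
    by rewrite -rowB -BE -row_mul [RHS]mxE.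
  have [t12 t1x t1y t1z t1r] := tP _ A1.
  have [t22 t2x t2y t2z t2r] := tP _ A2.
  have [t32 t3x t3y t3z t3r] := tP _ A3.
  have [t42 t4x t4y t4z t4r] := tP _ A4.
  have t_12 := tt _ _ A1 A2 j12.
  have t_13 := tt _ _ A1 A3 j13.
  have t_14 := tt _ _ A1 A4 j14.
  have t_23 := tt _ _ A2 A3 j23.
  have t_24 := tt _ _ A2 A4 j24.
  have t_34 := tt _ _ A3 A4 j34.
  rewrite !mxE.
  case: k => [[|[|[|[|[|[|[|[|k]]]]]]]] kP] //;
  case: l => [[|[|[|[|[|[|[|[|l]]]]]]]] lP] //=;
  by rewrite // innerC.
move=> i; split; first exact: u2.
  by rewrite BE /= ur.
move=> k; rewrite BE innerC.
case: k => [[|[|[|[|[|[|[|[|k]]]]]]]] kP] //=.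
by rewrite innerC ur.
Qed.

End FrameExistence.

(** * Roots attached to a pole *)

Lemma biangular_root_inner (R : realType) (x : R) (a b : bool) :
  [\/ x = 2, x = -2, x = 6 | x = -6] ->
  exists m : int, 4^-1 * ((-1) ^+ a * (-1) ^+ b * x - 2) = m%:~R /\ m != 2.
Proof.
case=> ->; case: a; case: b; rewrite ?expr0 ?expr1.
all: first [exists 0; split=> //; lra | exists 1; split=> //; lra
  | exists (-1); split=> //; lra | exists (-2); split=> //; lra].
Qed.

Section Pole.
Context {R : realType} {T : finType}.
Variables (w : T -> 'rV[R]_8) (r : 'rV[R]_8).
Hypotheses (wB : biangular w) (r2 : inner r r = 2)
  (rw : forall i, inner r (w i) = 2 \/ inner r (w i) = -2).

Definition pole_root i : 'rV[R]_8 :=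
  2^-1 *: ((-1) ^+ (inner r (w i) == -2) *: w i - r).

Let sgn i : bool := inner r (w i) == -2.

Let rw2 i : (-1) ^+ sgn i * inner r (w i) = 2.
Proof.
rewrite /sgn; case: (rw i) => ->; rewrite ?eqxx ?expr1; last by ring.
by rewrite (_ : 2 == -2 = false) ?expr0 ?mul1r //; apply/eqP; lra.
Qed.

Lemma pole_root_perp i : inner (pole_root i) r = 0.
Proof. by rewrite /pole_root !innerE2 r2 (innerC _ r) rw2; field. Qed.

Lemma pole_rootK i : w i = (-1) ^+ sgn i *: (r + 2 *: pole_root i).
Proof.
rewrite /pole_root scalerA mulfV ?pnatr_eq0 // scale1r addrC subrK scalerA.
by rewrite -expr2 sqrr_sign scale1r.
Qed.

Lemma pole_root_family : root_family pole_root.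
Proof.
have [w10 wij] := wB.
have ip i j : inner (pole_root i) (pole_root j)
   = 4^-1 * ((-1) ^+ sgn i * (-1) ^+ sgn j * inner (w i) (w j) - 2).
  rewrite /pole_root -/(sgn i) -/(sgn j) !innerE2 r2 (innerC _ r).
  move: (rw2 i) (rw2 j); move: (inner (w i) (w j)) (inner r (w i)) (inner r (w j)).
  by move: (_ ^+ sgn i) (_ ^+ sgn j) => b c a x y ex ey; clear -ex ey; lra.
have norm2 i : inner (pole_root i) (pole_root i) = 2.
  by rewrite ip -expr2 sqrr_sign w10; field.
(* The value 2 is excluded for distinct indices because this yields injectivity. *)
have ipZ i j : i != j -> exists m : int,
   inner (pole_root i) (pole_root j) = m%:~R /\ m != 2.
  by move=> /wij; rewrite ip; apply: biangular_root_inner.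
split=> // [i j ij|i j]; last first.
  have [->|/ipZ[m [-> _]]] := eqVneq i j; last exact: intr_int.
  by rewrite norm2; apply: intr_nat.
apply/eqP; apply: contraT => /ipZ[m []]; rewrite ij norm2 => /eqP.
by rewrite (eqr_int _ 2 m) => /eqP <-.
Qed.

Lemma pole_frame : #|T| = 126%N -> exists B,
  [/\ is_frame B, row 0 B = r & forall i, frame_dual B (pole_root i)].
Proof.
by move=> T126; apply: (exists_frame T126 pole_root_family r2 pole_root_perp).
Qed.

End Pole.

(** * Cardinality bound and rigidity of maximal families *)

Lemma perp_root_family_card (R : realType) (T : finType) (u : T -> 'rV[R]_8) r :
  root_family u -> inner r r = 2 -> (forall i, inner (u i) r = 0) -> (#|T| <= 126)%N.
Proof.
move=> uR r2 ur; apply: (@root_family_card _ _ _ u (proj_compl 1%:M r)) => //.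
- by apply: is_proj_compl; rewrite ?mulmx1 //; apply: is_proj1.
- by move=> i; apply: proj_complE; rewrite ?mulmx1.
- by rewrite trace_proj_compl // mxtrace1; ring.
Qed.

Lemma biangular_card (R : realType) (T : finType) (w : T -> 'rV[R]_8) :
  biangular w -> (#|T| <= 126)%N.
Proof.
move=> wB; have [[r [r2 rw]]|no] := pselect (exists r, inner r r = 2 /\
    forall m, inner r (w m) = 2 \/ inner r (w m) = -2).
  apply: (perp_root_family_card (pole_root_family wB r2 rw) r2).
  by move=> i; apply: pole_root_perp.
by apply: leq_trans (biangular_no_pole wB no) _.
Qed.

(** The vectors of a maximal family up to sign, described by the frame alone; this is what makes two
    such families comparable. *)
Definition frame_line (R : realType) (B : 'M[R]_8) (v : 'rV[R]_8) : Prop :=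
  exists2 d, frame_dual B d & v = row 0 B + 2 *: d \/ - v = row 0 B + 2 *: d.

Lemma frame_line_isometry (R : realType) (B Q : 'M[R]_8) v :
  Q *m Q^T = 1%:M -> frame_line B v -> frame_line (B *m Q) (v *m Q).
Proof.
move=> QQ [d [d2 d0 dZ] vd]; have dQ : (d *m Q) *m (B *m Q)^T = d *m B^T.
  by rewrite trmx_mul mulmxA -(mulmxA d) QQ mulmx1.
exists (d *m Q); first by split; rewrite ?inner_mulmx ?dQ.
by rewrite row_mul scalemxAl -mulmxDl -mulNmx; case: vd => <-; [left|right].
Qed.

(** A dual vector of the frame missing among the roots could be added to them by [frame_dual_int],
    giving 127 roots orthogonal to the pole. *)
Lemma biangular_lines (R : realType) (T : finType) (w : T -> 'rV[R]_8) :
  biangular w -> #|T| = 126%N -> exists2 B, is_frame B &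
  forall v, frame_line B v <-> exists i, w i = v \/ w i = - v.
Proof.
move=> wB T126; have [r [r2 rw]] : exists r, inner r r = 2 /\
    forall m, inner r (w m) = 2 \/ inner r (w m) = -2.
  by apply: contrapT => /(biangular_no_pole wB); rewrite T126.
have uR := pole_root_family wB r2 rw.
have [B [BB Br ud]] := pole_frame wB r2 rw T126.
set u := pole_root w r in uR ud.
have ur i : inner (u i) r = 0 by apply: pole_root_perp.
exists B => // v; rewrite /frame_line Br; split=> [[d dd vd]|[i wi]].
  have [i di] : exists i, u i = d.
    apply: contrapT => /forallNP no.
    suff : (#|{: option T}| <= 126)%N by rewrite card_option T126.
    pose u' o := if o is Some i then u i else d.
    have [uI u2 uZ] := uR; have [d2 d0 _] := dd.
    apply: (@perp_root_family_card _ _ u' r) => //.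
      split.
      - by move=> [i|] [j|] //= => [/uI->|/no|/esym/no].
      - by case.
      - move=> [i|] [j|] /=; apply: (frame_dual_int BB) => //; exact: ud.
    case=> //=; rewrite -d0 -Br; rewrite [RHS]mxE; apply: eq_bigr => l _.
    by rewrite !mxE.
  exists i; rewrite (pole_rootK w r i) -/(u i) di.
  by case: vd => <-; case: (_ == _); rewrite ?expr0 ?expr1 ?scaleN1r ?scale1r ?opprK;
    first [left; done | right; done].
exists (u i); first exact: ud.
move: wi; rewrite (pole_rootK w r i) -/(u i).
case: (_ == _); rewrite ?expr0 ?expr1 ?scaleN1r ?scale1r => -[e|e].
all: first [by left | by right; rewrite -e ?opprK | by left; apply: oppr_inj].
Qed.

(** A vector is negated exactly when its image under [Q] is not in [X']. The absence of antipodal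
    pairs in [X'] ensures that this choice reaches all of [X']. *)
Lemma equivalent_of_lines (R : realType) d (X X' : set 'rV[R]_d) (Q : 'M[R]_d) :
  Q *m Q^T = 1%:M ->
  (forall x, X' x -> ~ X' (- x)) ->
  (forall x, X x -> X' (x *m Q) \/ X' (- (x *m Q))) ->
  (forall x, X' x -> X (x *m Q^T) \/ X (- (x *m Q^T))) -> equivalent X X'.
Proof.
move=> QQ X'N XX' X'X; exists Q, (fun x => ~~ `[< X' (x *m Q) >]); split=> //.
have QQ' := mulmx1C QQ.
apply/seteqP; split=> [x' X'x'|_ [x Xx <-]].
  have [Xx|Xx] := X'X x' X'x'.
    exists (x' *m Q^T) => //; rewrite -mulmxA QQ' mulmx1.
    by rewrite (asboolT X'x') expr0 scale1r.
  exists (- (x' *m Q^T)) => //; rewrite mulNmx -mulmxA QQ' mulmx1.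
  by rewrite (asboolF (X'N _ X'x')) expr1 scaleN1r opprK.
case: asboolP => /= [|no]; first by rewrite expr0 scale1r.
by rewrite expr1 scaleN1r; case: (XX' x Xx).
Qed.

(** * Integer and real spans *)

Section IntegerSpan.
Context {R : realType} {n : nat}.
Implicit Types (G : set 'rV[R]_n) (v w : 'rV[R]_n).

Lemma Zspan_gen G v : G v -> Zspan G v.
Proof.
move=> Gv; exists 1%N, (fun=> v), (fun=> 1); split=> //.
by rewrite big_ord1 mulr1z.
Qed.

Lemma ZspanD G v w : Zspan G v -> Zspan G w -> Zspan G (v + w).
Proof.
move=> [k [g [c [Gg ->]]]] [l [g' [c' [Gg' ->]]]].
exists (k + l)%N, (fun i => match fintype.split i with inl j => g j | inr j => g' j end),
  (fun i => match fintype.split i with inl j => c j | inr j => c' j end); split.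
  by move=> i; case: (fintype.split i).
rewrite big_split_ord /=; congr (_ + _); apply: eq_bigr => i _.
  by rewrite (unsplitK (inl i)).
by rewrite (unsplitK (inr i)).
Qed.

Lemma Zspan_mulz G v m : G v -> Zspan G (v *~ m).
Proof.
by move=> Gv; exists 1%N, (fun=> v), (fun=> m); split; rewrite // big_ord1.
Qed.

Lemma inner_Zspan G v w : (forall g, G g -> inner v g \is a Num.int) ->
  Zspan G w -> inner v w \is a Num.int.
Proof.
move=> vG [k [g [c [Gg ->]]]]; rewrite innerC inner_suml rpred_sum // => i _.
by rewrite -scaler_int innerZl rpredM ?intr_int // innerC vG.
Qed.

Lemma Zspan_inner_int G G' v w :
  (forall g g', G g -> G' g' -> inner g g' \is a Num.int) ->
  Zspan G v -> Zspan G' w -> inner v w \is a Num.int.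
Proof.
move=> GG' Gv; apply: inner_Zspan => g' G'g'; rewrite innerC.
by apply: inner_Zspan Gv => g Gg; rewrite innerC GG'.
Qed.

Lemma Rspan_gen G v : G v -> Rspan G v.
Proof.
move=> Gv; exists 1%N, (fun=> v), (fun=> 1); split=> //.
by rewrite big_ord1 scale1r.
Qed.

End IntegerSpan.

(** * The roots of E_8 *)

Section E8.
Context {R : realType}.
Local Notation e k := (@std_basis R 8 k).

Lemma inner_std_basis (v : 'rV[R]_8) k : inner v (e k) = v 0 k.
Proof.
rewrite /inner (bigD1 k) //= mxE !eqxx mulr1 big1 ?addr0 // => l /negPf lk.
by rewrite mxE lk andbF mulr0.
Qed.

Lemma E8_int (v w : 'rV[R]_8) : E8 v -> E8 w -> inner v w \is a Num.int.
Proof.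
have ee k l : e k 0 l \is a Num.int by rewrite mxE rpred_nat.
have h1 k : inner (2^-1 *: const_mx 1) (e k) = 2^-1 :> R.
  by rewrite inner_std_basis !mxE mulr1.
have hh : inner (2^-1 *: const_mx 1) (2^-1 *: const_mx 1 : 'rV[R]_8) = 2.
  rewrite !innerE2 /inner (eq_bigr (fun=> 1)) ?sumr_const ?card_ord; first by field.
  by move=> k _; rewrite !mxE mulr1.
have hD (g : 'rV[R]_8) : D8 g -> inner (2^-1 *: const_mx 1) g \is a Num.int.
  apply: inner_Zspan => _ [k [l [->|->]]];
    have half : 2^-1 + 2^-1 = 1 :> R by field.
    by rewrite innerDr !h1 half rpred1.
  by rewrite innerBr !h1 subrr rpred0.
apply: Zspan_inner_int => g g' [Dg|->] [Dg'|->]; last by rewrite hh rpred_nat.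
- apply: Zspan_inner_int Dg Dg' => x y [k [l kl]] [k' [l' kl']].
  by case: kl => ->; case: kl' => ->; rewrite !innerE2 !inner_std_basis
    ?(rpredD, rpredB, rpredN).
- by rewrite innerC hD.
- exact: hD.
Qed.

(** Subtracting half the all-one vector when [b] holds leaves an integral vector [y] of even
    coordinate sum 2 h, which is the sum of the [y k] times [e k + e 0], minus [h] times
    [e 0 + e 0]. *)
Lemma E8_half (z : 'I_8 -> int) (b : bool) :
  (forall k, exists m, z k = 2 * m + b%:R) -> (exists m, \sum_k z k = 4 * m) ->
  E8 (\row_k (2^-1 * (z k)%:~R : R)).
Proof.
move=> zb [n zn]; have [y yE] := choice zb.
have yn : \sum_k y k = 2 * (n - (b : nat)%:R * 2).
  move: zn; under eq_bigr do rewrite yE.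
  rewrite big_split /= -mulr_sumr sumr_const card_ord; move: (\sum_k _) => s.
  by case: (b); lia.
set h := n - _ in yn.
have D8y : D8 (\sum_k e k *~ y k).
  have -> : \sum_k e k *~ y k = \sum_k (e k + e 0) *~ y k + (e 0 + e 0) *~ (- h).
    under [in RHS]eq_bigr do rewrite mulrzDl.
    rewrite big_split /= -mulrz_sumr -mulr2n -[_ *+ 2]/(e 0 *~ 2) -mulrzA yn.
    by rewrite mulrN mulrNz addrK.
  apply: ZspanD; last by apply: Zspan_mulz; exists 0, 0; left.
  exists 8%N, (fun k => e k + e 0), y; split=> // k.
  by exists k, 0; left.
have -> : \row_k (2^-1 * (z k)%:~R) =
   \sum_k e k *~ y k + (2^-1 *: const_mx 1) *~ (b : nat) :> 'rV[R]_8.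
  apply/rowP => k; rewrite !mxE summxE (bigD1 k) //= big1 => [|l /negPf lk].
    rewrite -!scaler_int !mxE !eqxx yE !mulr1 addr0 rmorphD rmorphM /=.
    by field.
  by rewrite -scaler_int !mxE eq_sym lk andbF mulr0.
apply: ZspanD; first by apply: Zspan_gen; left.
by apply: Zspan_mulz; right.
Qed.

(** Lists of integers make the checks on all roots decidable by evaluation. *)
Definition sumz (z : seq int) : int := foldr +%R 0 z.

Definition sign_vectors n : seq (seq int) :=
  iter n (fun L => map (cons 1) L ++ map (cons (-1)) L) [:: [::]].

Definition two_entries (i j : nat) (a b : int) : seq int :=
  mkseq (fun k => if k == i then a else if k == j then b else 0) 8.

(* Coordinates are multiplied by 2. *)
Definition E8_roots : seq (seq int) :=
  [seq z <- sign_vectors 8 | (sumz z %% 4 == 0)%Z] ++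
  [seq two_entries ij.1 ij.2 ab.1 ab.2 |
     ij <- [seq ij <- [seq (i, j) | i <- iota 0 8, j <- iota 0 8] | (ij.1 < ij.2)%N],
     ab <- [:: (2, 2); (2, -2); (-2, 2); (-2, -2)]].

(* The entries have the same parity, their sum is divisible by 4, and the sum of
   their squares is 8. *)
Definition E8_root_check (z : seq int) : bool :=
  [&& size z == 8%N, all (fun a => a == 2 * (a %/ 2)%Z + (head 0 z %% 2)%Z) z,
    sumz z == 4 * (sumz z %/ 4)%Z & sumz (map (fun a => a * a) z) == 8].

(** 240 = 128 + 112: the sign vectors with an even number of minus signs, and four vectors for each
    of the 28 pairs of coordinates. *)
Lemma E8_rootsP : [&& size E8_roots == 240%N, uniq E8_roots & all E8_root_check E8_roots].
Proof. by vm_compute. Qed.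

Lemma sumzE (f : int -> int) z : size z = 8%N -> \sum_(k < 8) f z`_k = sumz (map f z).
Proof.
by move=> z8; rewrite /sumz foldrE big_map [RHS](big_nth 0) z8 big_mkord.
Qed.

Definition E8_vec (z : seq int) : 'rV[R]_8 := \row_k (2^-1 * (z`_k)%:~R).

Lemma E8_vec_inj z z' : size z = 8%N -> size z' = 8%N -> E8_vec z = E8_vec z' -> z = z'.
Proof.
move=> z8 z8' /rowP zz'; apply: (@eq_from_nth _ 0); rewrite z8 // => k k8.
have := zz' (Ordinal k8); rewrite !mxE /= => /mulfI; rewrite invr_eq0 pnatr_eq0.
by move=> /(_ isT) /intr_inj.
Qed.

Lemma E8_vecP z : E8_root_check z -> E8 (E8_vec z) /\ inner (E8_vec z) (E8_vec z) = 2.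
Proof.
move=> /and4P[/eqP z8 /allP zpar /eqP zsum /eqP znorm]; split.
  apply: (@E8_half _ ((head 0 z %% 2)%Z == 1)) => [k|].
    have kz : (k < size z)%N by rewrite z8.
    have /eqP zk := zpar _ (mem_nth 0 kz).
    by exists (z`_k %/ 2)%Z; rewrite {1}zk; lia.
  by exists (sumz z %/ 4)%Z; rewrite -zsum -[in RHS](map_id z) -sumzE.
apply: (@mulfI _ 4); first by rewrite pnatr_eq0.
rewrite -natrM -[RHS](_ : 8%:~R = _) // -znorm -sumzE // rmorph_sum mulr_sumr.
by apply: eq_bigr => k _; rewrite !mxE rmorphM /=; field.
Qed.

Lemma E8_vec_family (L : seq (seq int)) : uniq L -> all E8_root_check L ->
  root_family (fun j : 'I_(size L) => E8_vec (nth [::] L j)).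
Proof.
move=> Luniq /allP Lok.
have ok (k : 'I_(size L)) : E8_root_check (nth [::] L k).
  by apply: Lok; apply: mem_nth.
have size8 (k : 'I_(size L)) : size (nth [::] L k) = 8%N.
  by have /and4P[/eqP] := ok k.
split=> [i j|i|i j]; [|by case: (E8_vecP (ok i))|].
  move=> /(E8_vec_inj (size8 i) (size8 j)) /eqP.
  by rewrite (nth_uniq _ (ltn_ord i) (ltn_ord j) Luniq) => /eqP/val_inj.
by apply: E8_int; [case: (E8_vecP (ok i))|case: (E8_vecP (ok j))].
Qed.

Lemma exists_E8_roots : exists x : 'I_240 -> 'rV[R]_8,
  root_family x /\ forall j, E8 (x j).
Proof.
have /and3P[/eqP L240 Luniq Lok] := E8_rootsP.
move: E8_roots L240 Luniq Lok => L L240; rewrite -L240 => Luniq Lok.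
exists (fun j => E8_vec (nth [::] L j)); split; first exact: E8_vec_family.
by move=> j; have [] := E8_vecP (allP Lok _ (mem_nth [::] (ltn_ord j))).
Qed.

Lemma card_E8_perp (x : 'I_240 -> 'rV[R]_8) r : root_family x ->
  (forall j, E8 (x j)) -> E8 r -> inner r r = 2 ->
  (126 <= #|[pred j | inner r (x j) == 0%R]|)%N.
Proof.
move=> uR xE8 rE8 r2; have [uI u2 uZ] := uR.
(* [card_inner1] in rank 7 + 1 reads 2 k <= 112. *)
have K y : inner y y = 2 -> #|inner1 x y|%:R <= 56 :> R.
  move=> y2; have := @card_inner1 R 8 'I_240 x 1%:M y uR (is_proj1)
    (fun=> mulmx1 _) (mulmx1 _) y2 7.
  rewrite mxtrace1 => /(_ ltac:(by ring) ltac:(by lra)); lra.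
have := K r r2; have := K (- r); rewrite !innerE2 opprK => /(_ r2).
have := sum_eq_le1 R predT r uI; have := sum_eq_le1 R predT (- r) uI.
set s1 := \sum_(j in _) _; set s2 := \sum_(j in _) _ => s1le s2le K1 K2.
pose Z : {pred 'I_240} := [pred j | inner r (x j) == 0].
rewrite -[X in (_ <= X)%N]/#|Z|.
have : \sum_(j : 'I_240) 1 <= \sum_j ((x j == r)%:R
   + (x j == - r)%:R + (j \in inner1 x r)%:R
   + (j \in inner1 x (- r))%:R + (j \in Z)%:R : R).
  apply: ler_sum => j _.
  have b0 (b : bool) : 0 <= b%:R :> R by rewrite ler0n.
  have := b0 (x j == r); have := b0 (x j == - r).
  have := b0 (j \in inner1 x r); have := b0 (j \in inner1 x (- r)).
  have := b0 (j \in Z).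
  rewrite !inE innerNl; case: (root_inner_cases r2 (u2 j) (E8_int rE8 (xE8 j))).
  - by move=> <-; rewrite eqxx /= => ? ? ? ? ?; lra.
  - by move=> ->; rewrite eqxx /= => ? ? ? ? ?; lra.
  - by move=> ->; rewrite eqxx /= => ? ? ? ? ?; lra.
  - by case=> ->; rewrite ?opprK eqxx /= => ? ? ? ? ?; lra.
rewrite !big_split /= -/s1 -/s2.
have cardE (A : {pred 'I_240}) : \sum_j (j \in A)%:R = #|A|%:R :> R.
  by rewrite -natr_sum -big_mkcond sum1_card.
rewrite !cardE sumr_const card_ord.
move=> le; rewrite -(ler_nat R); lra.
Qed.

End E8.

(** * From indexed families to sets of unit vectors *)

Definition biangular_set {R : realType} (X : set 'rV[R]_8) : Prop :=
  X `<=` sphere 8 /\ inner_values X `<=`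
    [set a | a = 1 / 5 \/ a = - (1 / 5) \/ a = 3 / 5 \/ a = - (3 / 5)].

Lemma card_le_family T (X : set T) n : (`I_n #<= X)%card ->
  exists x : 'I_n -> T, injective x /\ forall i, X (x i).
Proof.
move=> /card_leP[f]; pose k (i : 'I_n) : `I_n := exist _ (val i) (mem_set (ltn_ord i)).
exists (fun i => val (f (k i))); split=> [i j /val_inj|i]; last exact/set_mem/valP.
by move=> /(@inj _ _ _ f) /= ij; apply/val_inj/(congr1 val (ij _ _)); apply: mem_set.
Qed.

Lemma card_eq_family T (X : set T) n : (X #= `I_n)%card ->
  exists x : 'I_n -> T, injective x /\ forall v, X v <-> exists i, x i = v.
Proof.
rewrite card_eq_sym => /card_bijP[f /[dup] fB [g fK gK]].
pose k (i : 'I_n) : `I_n := exist _ (val i) (mem_set (ltn_ord i)).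
exists (fun i => val (f (k i))); split=> [i j /val_inj /(bij_inj fB) ij|v].
  exact/val_inj/(congr1 val ij).
split=> [Xv|[i <-]]; last exact/set_mem/valP.
pose s : X := exist _ v (mem_set Xv).
exists (Ordinal (set_mem (valP (g s)))).
by rewrite (_ : k _ = g s) ?gK //; apply: val_inj.
Qed.

Section BiangularSet.
Context {R : realType}.
Implicit Types X : set 'rV[R]_8.

Let s : R := Num.sqrt 10.

Let ss : s * s = 10.
Proof. by rewrite -expr2 sqr_sqrtr // ler0n. Qed.

Lemma biangular_scale X (T : finType) (x : T -> 'rV[R]_8) :
  biangular_set X -> injective x -> (forall i, X (x i)) ->
  biangular (fun i => s *: x i).
Proof.
move=> [Xs Xi] xI xX; split=> [i|i j ij].
  by rewrite innerZl innerZr mulrA ss (Xs _ (xX i)) mulr1.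
rewrite innerZl innerZr mulrA ss.
have : inner_values X (inner (x i) (x j)).
  by exists (x i), (x j); split=> //; rewrite (inj_eq xI).
case/Xi=> [->|[->|[->|->]]].
- by apply: Or41; lra.
- by apply: Or42; lra.
- by apply: Or43; lra.
- by apply: Or44; lra.
Qed.

Lemma biangular_set_card X : biangular_set X -> (X #<= `I_126)%card.
Proof.
move=> XB; apply: contrapT => /negP X126.
have [x [xI xX]] : exists x : 'I_127 -> 'rV[R]_8, injective x /\ forall i, X (x i).
  apply: card_le_family.
  have [[n Xn]|/infiniteP XN] := pselect (finite_set X); last first.
    by apply: card_le_trans XN; apply: subset_card_le.
  have [n126|n126] := leqP n 126.
    by case/negP: X126; rewrite (card_le_eql Xn) card_le_II.
  by rewrite (card_le_eqr Xn) card_le_II.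
by have := biangular_card (biangular_scale XB xI xX); rewrite card_ord.
Qed.

Lemma biangular_set_lines X : biangular_set X -> (X #= `I_126)%card ->
  exists2 B, is_frame B & forall v, frame_line B (s *: v) <-> X v \/ X (- v).
Proof.
move=> XB /card_eq_family[x [xI lines]].
have xX i : X (x i) by apply/lines; exists i.
have [B BB Bl] := biangular_lines (biangular_scale XB xI xX) (card_ord _).
have s0 : s != 0.
  by apply/eqP => s0; move: ss; rewrite s0 mul0r => /esym/eqP; rewrite pnatr_eq0.
exists B => // v; rewrite Bl; split=> [[i [|]]|[/lines[i <-]|/lines[i xi]]].
- by move=> /(scalerI s0) xi; left; apply/lines; exists i.
- by rewrite -scalerN => /(scalerI s0) xi; right; apply/lines; exists i.
- by exists i; left.
- by exists i; right; rewrite xi scalerN.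
Qed.

(** The isometry between the two frames carries frame lines to frame lines, hence [X] to [X'] up to
    signs. An antipodal pair would have the forbidden inner product -1. *)
Lemma biangular_set_unique X X' : biangular_set X -> biangular_set X' ->
  (X #= `I_126)%card -> (X' #= `I_126)%card -> equivalent X X'.
Proof.
move=> XB XB' X126 X126'.
have [B BB Bl] := biangular_set_lines XB X126.
have [B' BB' Bl'] := biangular_set_lines XB' X126'.
have [Q [QQ B'E]] := frame_isometry BB BB'.
have QQ' := mulmx1C QQ.
apply: (equivalent_of_lines QQ).
- move=> v X'v X'Nv; have [X's X'i] := XB'.
  have v1 := X's _ X'v; rewrite /sphere /= in v1.
  have : inner_values X' (-1).
    exists v, (- v); split=> //; last by rewrite innerNr v1.
    by apply/eqP => vN; move: v1; rewrite {1}vN innerNl; have := inner_ge0 v; lra.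
  by case/X'i=> [|[|[|]]]; lra.
- by move=> v Xv; apply/Bl'; rewrite B'E scalemxAl; apply: frame_line_isometry => //; apply/Bl; left.
- move=> v X'v; apply/Bl; rewrite scalemxAl.
  have -> : B = B' *m Q^T by rewrite B'E -mulmxA QQ mulmx1.
  by apply: frame_line_isometry; [rewrite trmxK|apply/Bl'; left].
Qed.

End BiangularSet.

(** * The configuration X_8 *)

Section X8.
Context {R : realType}.
Variables (r : 'rV[R]_8) (f : {linear 'rV[R]_8 -> 'rV[R]_7}).
Hypotheses (rE8 : lattice_roots E8 r) (fE7 : isometric_identification (E7 r) f).

Let lift (x : 'rV[R]_8) : 'rV[R]_(7 + 1) :=
  row_mx (Num.sqrt (2 / 5) *: f x) (const_mx (Num.sqrt (1 / 5))).

Let inner_lift x y : E7 r x -> E7 r y ->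
  inner (lift x) (lift y) = 2 / 5 * inner x y + 1 / 5.
Proof.
move=> xE yE; have [fiso _] := fE7.
rewrite -(fiso x y); [|exact: Rspan_gen..].
rewrite /inner big_split_ord big_ord1 /= !row_mxEr !mxE -expr2 sqr_sqrtr; last by lra.
congr (_ + _); rewrite mulr_sumr; apply: eq_bigr => i _.
rewrite !row_mxEl !mxE mulrACA -expr2 sqr_sqrtr //; lra.
Qed.

Lemma biangular_X8 : biangular_set (X8 r f).
Proof.
split.
  by move=> _ [x [xE x2] <-]; rewrite /sphere /= inner_lift // -/(normN x) x2; lra.
move=> _ [_ [_ [[x [xE x2] <-] [y [yE y2] <-] xy ->]]].
rewrite -/(lift x) -/(lift y) in xy *; rewrite inner_lift //=.
case: (root_inner_cases x2 y2 (E8_int xE.1 yE.1)) => [e|e|e|[e|e]].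
- by rewrite e eqxx in xy.
- by right; right; right; rewrite e innerNr -/(normN x) x2; lra.
- by right; right; left; rewrite e; lra.
- by left; rewrite e; lra.
- by right; left; rewrite e; lra.
Qed.

(** The upper bound is the general one, so exhibiting 126 distinct elements suffices. Equal lifts
    come from roots with inner product 2, that is, from equal roots. *)
Lemma card_X8 : (X8 r f #= `I_126)%card.
Proof.
have n2 : -2 <> 2 :> R by lra.
have n1 : -1 <> 2 :> R by lra.
have n25 : 2 / 5 <> 0 :> R by lra.
rewrite card_eq_le biangular_set_card ?andTb; last exact: biangular_X8.
have [rE r2] := rE8; have [x [xR xE8]] := @exists_E8_roots R.
have [_ x2 _] := xR; have card126 := card_E8_perp xR xE8 rE r2.
pose T := {: {j : 'I_240 | inner r (x j) == 0}}.
have cardT : (126 <= #|T|)%N by rewrite card_sig.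
pose g (i : 'I_126) : 'rV[R]_8 := x (val (enum_val (widen_ord cardT i))).
have gE i : lattice_roots (E7 r) (g i).
  rewrite /g; case: (enum_val _) => j /= /eqP rj.
  by split; [split; [exact: xE8|rewrite /= innerC]|exact: x2].
have gI : injective (fun i => lift (g i)).
  move=> i j ij; have [[iE i2] [jE j2]] := (gE i, gE j).
  have gg : inner (g i) (g j) = 2.
    have e := inner_lift iE jE.
    by move: e; rewrite -ij inner_lift // -/(normN (g i)) i2 => /addIr/mulfI -> //; apply/eqP.
  have [uI _ _] := xR; move: gg; clear ij.
  case: (root_inner_cases i2 j2 (E8_int iE.1 jE.1)) => [e _|->|->|[->|->]].
  - by apply/val_inj; have /uI/val_inj/enum_val_inj/(congr1 val) := e.
  - by rewrite innerNr -/(normN (g i)) i2 => /n2.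
  - by move=> /eqP; rewrite (eqr_nat _ 1 2).
  - by move=> /esym/eqP; rewrite pnatr_eq0.
  - by move=> /n1.
have e : ((fun i => lift (g i)) @` [set: 'I_126] #= `I_126)%card.
  apply: card_eq_trans (card_esym card_II).
  by apply: inj_card_eq => i j _ _ /gI.
rewrite -(card_le_eql e); apply: subset_card_le => _ [i _ <-].
by exists (g i) => //; exact: gE.
Qed.

End X8.

Theorem theorem5p5 (R : realType) (X : set 'rV[R]_8)
    (X_sphere : X `<=` sphere 8)
    (X_inner : inner_values X `<=`
       [set a | a = 1 / 5 \/ a = - (1 / 5) \/ a = 3 / 5 \/ a = - (3 / 5)]) :
  (X #<= `I_126)%card /\
  ((X #= `I_126)%card ->
   forall (r : 'rV[R]_8) (f : {linear 'rV[R]_8 -> 'rV[R]_7}),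
     lattice_roots E8 r -> isometric_identification (E7 r) f ->
     equivalent X (X8 r f)).
Proof.
split=> [|X126 r f rE8 fE7]; first exact: biangular_set_card.
apply: biangular_set_unique => //; first exact: biangular_X8.
exact: card_X8.
Qed.
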